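(* The adjunction $(i,\tau_{\geq 0})$, where $i:\mathsf{dgcat}_{\geq 0}\hookrightarrow\mathsf{dgcat}$ is the inclusion and $\tau_{\geq 0}:\mathsf{dgcat}\to\mathsf{dgcat}_{\geq 0}$ is the truncation functor, is a Quillen adjunction.
   Context: Let $k$ be a commutative ring with unit. $\mathsf{Ch}$ is the category of (unbounded) complexes of $k$-modules, homologically graded, and $\mathsf{Ch}_{\geq 0}$ the full subcategory of complexes concentrated in degrees $\geq 0$; both are symmetric monoidal under $\otimes=\otimes_k$. $\mathsf{dgcat}$ (resp. $\mathsf{dgcat}_{\geq 0}$) is the category of small categories enriched over $\mathsf{Ch}$ (resp. $\mathsf{Ch}_{\geq 0}$). Truncation: for $M\in\mathsf{Ch}$, $\tau_{\geq 0}M$ is $\operatorname{Ker}(d_0:M_0\to M_{-1})$ in degree $0$, $M_n$ in degree $n\geq 1$, and $0$ in negative degrees. This is a lax monoidal functor, right adjoint to the inclusion. For $\mathcal{A}\in\mathsf{dgcat}$, $\tau_{\geq 0}\mathcal{A}$ has the same objects, $(\tau_{\geq 0}\mathcal{A})(x,y)=\tau_{\geq 0}(\mathcal{A}(x,y))$, composition induced by the lax monoidal structure and the composition of $\mathcal{A}$, and the same units. It is right adjoint to $i$. Quasi-equivalence (in either category): a dg functor $G:\mathcal{A}\to\mathcal{B}$ such that every $\mathcal{A}(x,y)\to\mathcal{B}(Gx,Gy)$ is a quasi-isomorphism and $\mathsf{H}_0(G)$ is essentially surjective, where $\mathsf{H}_0(\mathcal{A})$ has the same objects and morphisms $\mathsf{H}_0(\mathcal{A}(x,y))$.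 Dg functors: $\mathcal{K}$ has objects $1,2$ and morphisms freely generated by $f\in\mathcal{K}(1,2)_0$, $g\in\mathcal{K}(2,1)_0$, $r_1\in\mathcal{K}(1,1)_1$, $r_2\in\mathcal{K}(2,2)_1$, $r_{12}\in\mathcal{K}(1,2)_2$, subject to $d(f)=d(g)=0$, $d(r_1)=gf-\mathbf{1}_1$, $d(r_2)=fg-\mathbf{1}_2$, $d(r_{12})=fr_1-r_2f$; $\underline{k}$ has one object $3$, $\underline{k}(3,3)=k$; $F:\underline{k}\to\mathcal{K}$ sends $3\mapsto 1$. $\mathcal{B}$ has objects $4,5$, $\mathcal{B}(4,4)=\mathcal{B}(5,5)=k$, zero other Homs. For $n\in\mathbb{Z}$, $S^{n-1}=k[n-1]$ is $k$ in degree $n-1$, $D^n$ is the mapping cone of its identity; $\mathcal{P}(n)$ has objects $6,7$, $\mathcal{P}(n)(6,6)=\mathcal{P}(n)(7,7)=k$, $\mathcal{P}(n)(7,6)=0$, $\mathcal{P}(n)(6,7)=D^n$; $\mathcal{C}(n)$ has objects $8,9$, $\mathcal{C}(n)(8,8)=\mathcal{C}(n)(9,9)=k$, $\mathcal{C}(n)(9,8)=0$, $\mathcal{C}(n)(8,9)=S^{n-1}$. $R(n):\mathcal{B}\to\mathcal{P}(n)$ sends $4\mapsto 6$, $5\mapsto 7$; $S(n):\mathcal{C}(n)\to\mathcal{P}(n)$ sends $8\mapsto 6$, $9\mapsto 7$ and $S^{n-1}$ to $D^n$ by the identity of $k$ in degree $n-1$; $Q:\emptyset\to\underline{k}$ is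 the unique dg functor; $N:\mathcal{B}\to\mathcal{C}(1)$ sends $4\mapsto 8$, $5\mapsto 9$. Model structures (cofibrantly generated, weak equivalences the quasi-equivalences): on $\mathsf{dgcat}$ the generating cofibrations are $Q$ and $S(n)$, $n\in\mathbb{Z}$, and the generating trivial cofibrations are $F$ and $R(n)$, $n\in\mathbb{Z}$; on $\mathsf{dgcat}_{\geq 0}$ the generating cofibrations are $Q$, $N$ and $S(n)$, $n\geq 1$, and the generating trivial cofibrations are $F$ and $R(n)$, $n\geq 1$. *)

(* Defs.v *)
From HB Require Import structures.
From mathcomp Require Import all_boot all_order all_algebra.
From mathcomp Require Import ring_quotient.
From mathcomp Require Import boolp.
From mathcomp Require Import finmap.
From mathcomp.multinomials Require Import monalg.

Set Implicit Arguments.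
Unset Strict Implicit.
Unset Printing Implicit Defensive.

Import Order.TTheory GRing.Theory Num.Theory.
Local Open Scope ring_scope.

Record category := Category {
  ob :> Type;
  hom : ob -> ob -> Type;
  idm : forall x, hom x x;
  compm : forall x y z, hom y z -> hom x y -> hom x z;
  compmA : forall x y z t (h : hom z t) (g : hom y z) (f : hom x y),
    compm h (compm g f) = compm (compm h g) f;
  comp1m : forall x y (f : hom x y), compm (idm y) f = f;
  compm1 : forall x y (f : hom x y), compm f (idm x) = f
}.
Arguments hom {c}.
Arguments idm {c}.
Arguments compm {c x y z}.

Record functor (C D : category) := Functor {
  fob :> C -> D;
  fmor : forall x y : C, hom x y -> hom (fob x) (fob y);
  fmor1 : forall x : C, fmor (idm x) = idm (fob x);
  fmorM : forall (x y z : C) (g : hom y z) (f : hom x y),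
    fmor (compm g f) = compm (fmor g) (fmor f)
}.
Arguments fmor {C D} f0 {x y}.

Record adjunction (C D : category) (L : functor C D) (R : functor D C) :=
  Adjunction {
  adj_unit : forall x : C, hom x (R (L x));
  adj_counit : forall y : D, hom (L (R y)) y;
  adj_unit_nat : forall (x x' : C) (f : hom x x'),
    compm (adj_unit x') f = compm (fmor R (fmor L f)) (adj_unit x);
  adj_counit_nat : forall (y y' : D) (g : hom y y'),
    compm g (adj_counit y) = compm (adj_counit y') (fmor L (fmor R g));
  adj_triL : forall x : C,
    compm (adj_counit (L x)) (fmor L (adj_unit x)) = idm (L x);
  adj_triR : forall y : D,
    compm (fmor R (adj_counit y)) (adj_unit (R y)) = idm (R y)
}.

Definition isomorphic (C : category) (x y : C) : Prop :=
  exists (f : hom x y) (g : hom y x), compm g f = idm x /\ compm f g = idm y.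

Definition essentially_surjective (C D : category) (F : functor C D) : Prop :=
  forall y : D, exists x : C, isomorphic (F x) y.

Section FullSubcategory.
Variables (C : category) (P : C -> Prop).

Definition full_subcategory : category :=
  @Category {x : C | P x} (fun x y => hom (sval x) (sval y))
    (fun x => idm (sval x)) (fun x y z g f => compm g f)
    (fun x y z t h g f => compmA h g f)
    (fun x y f => comp1m f) (fun x y f => compm1 f).

Definition full_inclusion : functor full_subcategory C :=
  @Functor full_subcategory C (fun x => sval x) (fun x y f => f)
    (fun x => erefl) (fun x y z g f => erefl).
End FullSubcategory.

Definition mor_class (C : category) := forall x y : C, hom x y -> Prop.

Section Lifting.
Variable C : category.
Implicit Types K : mor_class C.

Definition lifts (a b x y : C) (i : hom a b) (p : hom x y) : Prop :=
  forall (u : hom a x) (v : hom b y), compm p u = compm v i ->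
  exists h : hom b x, compm h i = u /\ compm p h = v.

Definition rlp K : mor_class C :=
  fun x y p => forall (a b : C) (i : hom a b), K a b i -> lifts i p.

Definition meet_class K K' : mor_class C := fun x y f => K x y f /\ K' x y f.

Definition eq_class K K' : Prop := forall x y (f : hom x y), K x y f <-> K' x y f.

Definition retract (x y x' y' : C) (f : hom x y) (g : hom x' y') : Prop :=
  exists (i : hom x x') (r : hom x' x) (j : hom y y') (s : hom y' y),
  [/\ compm r i = idm x, compm s j = idm y,
      compm g i = compm j f & compm f r = compm s g].

Definition retract_closed K : Prop :=
  forall (x y x' y' : C) (f : hom x y) (g : hom x' y'),
  retract f g -> K x' y' g -> K x y f.

Definition two_of_three K : Prop :=
  forall (x y z : C) (f : hom x y) (g : hom y z),
  [/\ K x y f -> K y z g -> K x z (compm g f),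
      K x y f -> K x z (compm g f) -> K y z g &
      K y z g -> K x z (compm g f) -> K x y f].

Definition factors K K' : Prop :=
  forall (x y : C) (f : hom x y), exists (z : C) (i : hom x z) (p : hom z y),
  [/\ K x z i, K' z y p & compm p i = f].

End Lifting.

Record model_structure (C : category) := ModelStructure {
  weq : mor_class C;
  fib : mor_class C;
  cof : mor_class C;
  weq_2of3 : two_of_three weq;
  weq_retract : retract_closed weq;
  fib_retract : retract_closed fib;
  cof_retract : retract_closed cof;
  tcof_lift : forall (a b x y : C) (i : hom a b) (p : hom x y),
    meet_class cof weq i -> fib p -> lifts i p;
  cof_lift : forall (a b x y : C) (i : hom a b) (p : hom x y),
    cof i -> meet_class fib weq p -> lifts i p;
  tcof_fib_factor : factors (meet_class cof weq) fib;
  cof_tfib_factor : factors cof (meet_class fib weq)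
}.
Arguments weq {C} m {x y}.
Arguments fib {C} m {x y}.
Arguments cof {C} m {x y}.

(* The model structure [M] has weak equivalences [W], generating cofibrations
   [I] and generating trivial cofibrations [J].  The smallness conditions on
   the domains of [I] and [J] play no role in determining [M] and are omitted. *)
Definition cofibrantly_generated_by (C : category) (M : model_structure C)
    (W I J : mor_class C) : Prop :=
  [/\ eq_class (@weq C M) W,
      eq_class (@fib C M) (rlp J) &
      eq_class (meet_class (@fib C M) (@weq C M)) (rlp I)].

Section Quillen.
Variables (C D : category) (MC : model_structure C) (MD : model_structure D).

Definition left_quillen (L : functor C D) : Prop :=
  forall (x y : C) (f : hom x y),
  (cof MC f -> cof MD (fmor L f)) /\
  (cof MC f /\ weq MC f -> cof MD (fmor L f) /\ weq MD (fmor L f)).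

Definition right_quillen (R : functor D C) : Prop :=
  forall (x y : D) (f : hom x y),
  (fib MD f -> fib MC (fmor R f)) /\
  (fib MD f /\ weq MD f -> fib MC (fmor R f) /\ weq MC (fmor R f)).

Definition quillen_adjunction (L : functor C D) (R : functor D C)
    (adj : adjunction L R) : Prop :=
  left_quillen L /\ right_quillen R.
End Quillen.

Section Submodule.
Variables (k : pzRingType) (V : lmodType k) (S : submodClosed V).

Record submod := Submod { submod_val :> V; submod_mem : submod_val \in S }.

HB.instance Definition _ := [isSub for submod_val].
HB.instance Definition _ := [Choice of submod by <:].
HB.instance Definition _ := [SubChoice_isSubLmodule of submod by <:].
End Submodule.

(* The index equation [m = n + 1] is an argument of the differential (and, below,
   [m + n = p] of the composition), so that no transport along equalities in
   [int] is needed to state the axioms. *)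
Record complex (k : comPzRingType) := Complex {
  cx :> int -> lmodType k;
  dif : forall m n : int, m = n + 1 -> {linear cx m -> cx n};
  dif_dif : forall (m n p : int) (e : m = n + 1) (e' : n = p + 1) (x : cx m),
    dif e' (dif e x) = 0
}.
Arguments dif {k c m n}.

Record chain_map (k : comPzRingType) (M N : complex k) := ChainMap {
  cmap :> forall n : int, M n -> N n;
  cmap_linear : forall n : int, linear (@cmap n);
  cmap_dif : forall (m n : int) (e : m = n + 1) (x : M m),
    @cmap n (dif e x) = dif e (@cmap m x)
}.
Arguments cmap {k M N} c n x.
Arguments cmap_linear {k M N} c n.

HB.instance Definition _ (k : comPzRingType) (M N : complex k)
    (f : chain_map M N) (n : int) :=
  GRing.isLinear.Build k (M n) (N n) _ (cmap f n) (cmap_linear f n).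

Section ComplexTheory.
Variable k : comPzRingType.
Implicit Types M N : complex k.

Lemma chain_map_eq M N (f g : chain_map M N) :
  (forall n x, f n x = g n x) -> f = g.
Proof.
case: f g => [f fl fd] [g gl gd] /= fg.
have E : f = g by apply: functional_extensionality_dep => n; exact/funext/fg.
by subst g; congr ChainMap; exact: Prop_irrelevance.
Qed.

Definition chain_id M : chain_map M M :=
  @ChainMap k M M (fun n x => x) (fun n a x y => erefl) (fun m n e x => erefl).

Lemma chain_comp_linear M N P (g : chain_map N P) (f : chain_map M N) n :
  linear (fun x => g n (f n x)).
Proof. by move=> a x y; rewrite !linearP. Qed.

Lemma chain_comp_dif M N P (g : chain_map N P) (f : chain_map M N)
    m n (e : m = n + 1) (x : M m) :
  g n (f n (dif e x)) = dif e (g m (f m x)).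
Proof. by rewrite !cmap_dif. Qed.

Definition chain_comp M N P (g : chain_map N P) (f : chain_map M N) :
  chain_map M P :=
  ChainMap (chain_comp_linear g f) (chain_comp_dif g f).

Definition cast M (m n : int) (e : m = n) : M m -> M n :=
  eq_rect m (fun i => M m -> M i) id n e.

Lemma castE M n (e : n = n) x : @cast M n n e x = x.
Proof. by rewrite (eq_irrelevance e erefl). Qed.

Lemma cast_linear M m n (e : m = n) : linear (@cast M m n e).
Proof. by case: n / e => a x y. Qed.

HB.instance Definition _ M (m n : int) (e : m = n) :=
  GRing.isLinear.Build k (M m) (M n) _ (@cast M m n e) (@cast_linear M m n e).

Lemma dif_irr M (m n : int) (e e' : m = n + 1) (x : M m) : dif e x = dif e' x.
Proof. by rewrite (eq_irrelevance e e'). Qed.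

Definition int_pred1K (n : int) : n = n - 1 + 1 := esym (subrK 1 n).

Definition cycle_pred M n : {pred M n} :=
  fun x => dif (int_pred1K n) x == 0.

Lemma cycle_submod_closed M n : submod_closed (@cycle_pred M n).
Proof.
split=> [|a x y]; rewrite !unfold_in /cycle_pred ?linear0 //.
by move=> /eqP hx /eqP hy; rewrite linearP hx hy scaler0 addr0.
Qed.
HB.instance Definition _ M n :=
  GRing.isSubmodClosed.Build k (M n) (@cycle_pred M n) (cycle_submod_closed M n).

Definition cycles M n : lmodType k := submod (@cycle_pred M n).

Definition boundary_pred M n : {pred cycles M n} :=
  fun z => `[< exists y : M (n + 1), dif erefl y = val z >].

Lemma boundary_zmod_closed M n : zmod_closed (@boundary_pred M n).
Proof.
split; first by apply/asboolP; exists 0; rewrite linear0.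
move=> x y /asboolP[x' hx] /asboolP[y' hy]; apply/asboolP.
by exists (x' - y'); rewrite linearB hx hy.
Qed.
HB.instance Definition _ M n :=
  GRing.isZmodClosed.Build (cycles M n) (@boundary_pred M n)
    (boundary_zmod_closed M n).

Definition homology M n : zmodType := Quotient.quot (@boundary_pred M n).

End ComplexTheory.

Section HomologyMaps.
Variable k : comPzRingType.
Implicit Types M N : complex k.

Definition hclass M n (z : cycles M n) : homology M n := (\pi z)%qT.

Lemma hclassP M n (z z' : cycles M n) :
  hclass z = hclass z' <-> exists y : M (n + 1), dif erefl y = val z - val z'.
Proof.
split=> [/eqP|h]; first by rewrite -Quotient.idealrBE => /asboolP.
by apply/eqP; rewrite -Quotient.idealrBE; apply/asboolP.
Qed.

Lemma hclassK M n (c : homology M n) : hclass (repr c) = c.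
Proof. exact: reprK. Qed.

Lemma cycleP M n (z : cycles M n) m (e : n = m + 1) : dif e (val z) = 0.
Proof.
have E : m = n - 1 by rewrite e addrK.
by subst m; rewrite (dif_irr e (int_pred1K n)); apply/eqP/(valP z).
Qed.

Lemma mem_cycle M n (x : M n) m (e : n = m + 1) :
  dif e x = 0 -> x \in @cycle_pred k M n.
Proof.
have E : m = n - 1 by rewrite e addrK.
by subst m; rewrite (dif_irr e (int_pred1K n)) unfold_in => /eqP.
Qed.

Lemma cycle_map_subproof M N (f : chain_map M N) n (z : cycles M n) :
  f n (val z) \in @cycle_pred k N n.
Proof. by apply: (mem_cycle (e := int_pred1K n)); rewrite -cmap_dif cycleP linear0. Qed.

Definition cycle_map M N (f : chain_map M N) n (z : cycles M n) : cycles N n :=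
  Submod (cycle_map_subproof f z).

Definition homology_map M N (f : chain_map M N) n (c : homology M n) :
  homology N n := hclass (cycle_map f (repr c)).

Lemma homology_mapE M N (f : chain_map M N) n (z : cycles M n) :
  homology_map f (hclass z) = hclass (cycle_map f z).
Proof.
apply/hclassP; have /hclassP[y hy] := hclassK (hclass z).
by exists (f _ y); rewrite -cmap_dif hy linearB.
Qed.

(* [homology] is only given its additive group structure; since [f] is linear,
   bijectivity amounts to being an isomorphism of [k]-modules. *)
Definition quasi_isomorphism M N (f : chain_map M N) : Prop :=
  forall n : int, bijective (@homology_map M N f n).
End HomologyMaps.

(* A category enriched over complexes: a chain map [A(y,z) (x) A(x,y) -> A(x,z)]
   out of the tensor product is a bilinear map, additive on degrees, subject to
   the graded Leibniz rule; the unit [k -> A(x,x)] is a cycle of degree [0]. *)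
Record dgcat (k : comPzRingType) := DGCat {
  dgob :> Type;
  dghom : dgob -> dgob -> complex k;
  dgcomp : forall (x y z : dgob) (m n p : int), m + n = p ->
    dghom y z m -> dghom x y n -> dghom x z p;
  dgone : forall x : dgob, dghom x x 0;
  dgcomp_linearl : forall (x y z : dgob) (m n p : int) (e : m + n = p)
    (f : dghom x y n), linear (fun g : dghom y z m => dgcomp e g f);
  dgcomp_linearr : forall (x y z : dgob) (m n p : int) (e : m + n = p)
    (g : dghom y z m), linear (fun f : dghom x y n => dgcomp e g f);
  dgcomp_dif : forall (x y z : dgob) (m n p m' n' p' : int)
    (em : m = m' + 1) (en : n = n' + 1) (ep : p = p' + 1)
    (e : m + n = p) (el : m' + n = p') (er : m + n' = p')
    (g : dghom y z m) (f : dghom x y n),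
    dif ep (dgcomp e g f) =
      dgcomp el (dif em g) f + (-1) ^+ `|m|%N *: dgcomp er g (dif en f);
  dgone_dif : forall (x : dgob) (n : int) (e : 0 = n + 1), dif e (dgone x) = 0;
  dgcompA : forall (x y z t : dgob) (m n p mn np q : int)
    (emn : m + n = mn) (enp : n + p = np) (e : m + np = q) (e' : mn + p = q)
    (h : dghom z t m) (g : dghom y z n) (f : dghom x y p),
    dgcomp e h (dgcomp enp g f) = dgcomp e' (dgcomp emn h g) f;
  dgcomp1f : forall (x y : dgob) (n : int) (e : 0 + n = n) (f : dghom x y n),
    dgcomp e (dgone y) f = f;
  dgcompf1 : forall (x y : dgob) (n : int) (e : n + 0 = n) (f : dghom x y n),
    dgcomp e f (dgone x) = f
}.
Arguments dghom {k d}.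
Arguments dgcomp {k d x y z m n p}.
Arguments dgone {k d}.

Record dgfunctor (k : comPzRingType) (A B : dgcat k) := DGFunctor {
  dgfob :> A -> B;
  dgfmor : forall x y : A, chain_map (dghom x y) (dghom (dgfob x) (dgfob y));
  dgfmorM : forall (x y z : A) (m n p : int) (e : m + n = p)
    (g : dghom y z m) (f : dghom x y n),
    dgfmor x z p (dgcomp e g f) = dgcomp e (dgfmor y z m g) (dgfmor x y n f);
  dgfmor1 : forall x : A, dgfmor x x 0 (dgone x) = dgone (dgfob x)
}.
Arguments dgfmor {k A B} d x y.

Section DGCategory.
Variable k : comPzRingType.
Implicit Types A B : dgcat k.

Lemma dgcomp_irr A (x y z : A) m n p (e e' : m + n = p)
  (g : dghom y z m) (f : dghom x y n) : dgcomp e g f = dgcomp e' g f.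
Proof. by rewrite (eq_irrelevance e e'). Qed.

Lemma dgcompBl A (x y z : A) m n p (e : m + n = p)
    (g g' : dghom y z m) (f : dghom x y n) :
  dgcomp e (g - g') f = dgcomp e g f - dgcomp e g' f.
Proof.
have /= E := dgcomp_linearl e f (-1) g' g.
by rewrite addrC -scaleN1r E scaleN1r addrC.
Qed.

Lemma dgcompBr A (x y z : A) m n p (e : m + n = p)
    (g : dghom y z m) (f f' : dghom x y n) :
  dgcomp e g (f - f') = dgcomp e g f - dgcomp e g f'.
Proof.
have /= E := dgcomp_linearr e g (-1) f' f.
by rewrite addrC -scaleN1r E scaleN1r addrC.
Qed.

Lemma dgcomp0f A (x y z : A) m n p (e : m + n = p) (f : dghom x y n) :
  dgcomp e (0 : dghom y z m) f = 0.
Proof. by have := dgcompBl e (0 : dghom y z m) 0 f; rewrite !subrr. Qed.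

Lemma dgcompf0 A (x y z : A) m n p (e : m + n = p) (g : dghom y z m) :
  dgcomp e g (0 : dghom x y n) = 0.
Proof. by have := dgcompBr e g (0 : dghom x y n) 0; rewrite !subrr. Qed.

Lemma dgfunctor_eq A B (F G : dgfunctor A B) (e : dgfob F = dgfob G) :
  (forall x y, eq_rect (dgfob F)
     (fun H : A -> B => chain_map (dghom x y) (dghom (H x) (H y)))
     (dgfmor F x y) (dgfob G) e = dgfmor G x y) -> F = G.
Proof.
case: F G e => [F Fm FM F1] [G Gm GM G1] /= e; subst G => /= H.
have E : Fm = Gm.
  by apply: functional_extensionality_dep => x;
     apply: functional_extensionality_dep => y; exact: H.
by subst Gm; congr DGFunctor; exact: Prop_irrelevance.
Qed.

Definition dgfunctor_id A : dgfunctor A A :=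
  @DGFunctor k A A (fun x => x) (fun x y => chain_id (dghom x y))
    (fun x y z m n p e g f => erefl) (fun x => erefl).

Lemma dgfunctor_compM A B C (G : dgfunctor B C) (F : dgfunctor A B)
    (x y z : A) (m n p : int) (e : m + n = p) (g : dghom y z m) (f : dghom x y n) :
  chain_comp (dgfmor G (F x) (F z)) (dgfmor F x z) p (dgcomp e g f) =
  dgcomp e (chain_comp (dgfmor G (F y) (F z)) (dgfmor F y z) m g)
           (chain_comp (dgfmor G (F x) (F y)) (dgfmor F x y) n f).
Proof. by rewrite /= !dgfmorM. Qed.

Lemma dgfunctor_comp1 A B C (G : dgfunctor B C) (F : dgfunctor A B) (x : A) :
  chain_comp (dgfmor G (F x) (F x)) (dgfmor F x x) 0 (dgone x) = dgone (G (F x)).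
Proof. by rewrite /= !dgfmor1. Qed.

Definition dgfunctor_comp A B C (G : dgfunctor B C) (F : dgfunctor A B) :
  dgfunctor A C :=
  @DGFunctor k A C (fun x => G (F x))
    (fun x y => chain_comp (dgfmor G (F x) (F y)) (dgfmor F x y))
    (dgfunctor_compM G F) (dgfunctor_comp1 G F).

Lemma dgfunctor_compA A B C D (H : dgfunctor C D) (G : dgfunctor B C)
    (F : dgfunctor A B) :
  dgfunctor_comp H (dgfunctor_comp G F) = dgfunctor_comp (dgfunctor_comp H G) F.
Proof. by unshelve refine (dgfunctor_eq (e := _) _) => // x y; exact: chain_map_eq. Qed.

Lemma dgfunctor_comp1f A B (F : dgfunctor A B) :
  dgfunctor_comp (dgfunctor_id B) F = F.
Proof. by unshelve refine (dgfunctor_eq (e := _) _) => // x y; exact: chain_map_eq. Qed.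

Lemma dgfunctor_compf1 A B (F : dgfunctor A B) :
  dgfunctor_comp F (dgfunctor_id A) = F.
Proof. by unshelve refine (dgfunctor_eq (e := _) _) => // x y; exact: chain_map_eq. Qed.

Definition DGCAT : category :=
  @Category (dgcat k) (@dgfunctor k) dgfunctor_id
    (fun A B C G F => dgfunctor_comp G F)
    dgfunctor_compA dgfunctor_comp1f dgfunctor_compf1.

Lemma dgcomp_cycle A (x y z : A) (g : cycles (dghom y z) 0)
    (f : cycles (dghom x y) 0) :
  dgcomp (addr0 0) (val g) (val f) \in @cycle_pred k (dghom x z) 0.
Proof.
apply: (mem_cycle (e := int_pred1K 0)).
rewrite (dgcomp_dif (int_pred1K 0) (int_pred1K 0) _ _ (addr0 _) (add0r _)).
by rewrite !cycleP dgcomp0f dgcompf0 scaler0 addr0.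
Qed.

Definition cycle_comp A (x y z : A) (g : cycles (dghom y z) 0)
    (f : cycles (dghom x y) 0) : cycles (dghom x z) 0 :=
  Submod (dgcomp_cycle g f).

Definition cycle_one A (x : A) : cycles (dghom x x) 0 :=
  Submod (mem_cycle (dgone_dif x (int_pred1K 0))).

Definition H0_comp A (x y z : A) (g : homology (dghom y z) 0)
    (f : homology (dghom x y) 0) : homology (dghom x z) 0 :=
  hclass (cycle_comp (repr g) (repr f)).

Lemma H0_compE A (x y z : A) (g : cycles (dghom y z) 0)
    (f : cycles (dghom x y) 0) :
  H0_comp (hclass g) (hclass f) = hclass (cycle_comp g f).
Proof.
rewrite /H0_comp; move: (hclassK (hclass g)) (hclassK (hclass f)).
move: (repr (hclass g)) (repr (hclass f)) => g' f'.
move=> /hclassP[b hb] /hclassP[c hc]; apply/hclassP.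
exists (dgcomp (addr0 _) b (val f') + dgcomp (add0r _) (val g) c).
rewrite linearD.
rewrite (dgcomp_dif erefl (int_pred1K 0) _ _ (addr0 0) erefl) cycleP dgcompf0.
rewrite (dgcomp_dif (int_pred1K 0) erefl _ _ erefl (addr0 0)) cycleP dgcomp0f.
rewrite hb hc scaler0 addr0 add0r expr0 scale1r dgcompBl dgcompBr.
by rewrite addrA subrK.
Qed.

Lemma H0_compA A (x y z t : A) (h : homology (dghom z t) 0)
    (g : homology (dghom y z) 0) (f : homology (dghom x y) 0) :
  H0_comp h (H0_comp g f) = H0_comp (H0_comp h g) f.
Proof.
rewrite -(hclassK h) -(hclassK g) -(hclassK f) !H0_compE.
by congr hclass; apply: val_inj; exact: dgcompA.
Qed.

Lemma H0_comp1f A (x y : A) (f : homology (dghom x y) 0) :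
  H0_comp (hclass (cycle_one y)) f = f.
Proof.
rewrite -(hclassK f) H0_compE.
by congr hclass; apply: val_inj; exact: dgcomp1f.
Qed.

Lemma H0_compf1 A (x y : A) (f : homology (dghom x y) 0) :
  H0_comp f (hclass (cycle_one x)) = f.
Proof.
rewrite -(hclassK f) H0_compE.
by congr hclass; apply: val_inj; exact: dgcompf1.
Qed.

Definition H0 A : category :=
  @Category (dgob A) (fun x y => homology (dghom x y) 0)
    (fun x => hclass (cycle_one x)) (fun x y z g f => H0_comp g f)
    (@H0_compA A) (@H0_comp1f A) (@H0_compf1 A).

Lemma H0_functor1 A B (G : dgfunctor A B) (x : A) :
  homology_map (dgfmor G x x) (hclass (cycle_one x)) = hclass (cycle_one (G x)).
Proof.
by rewrite homology_mapE; congr hclass; apply: val_inj; exact: dgfmor1.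
Qed.

Lemma H0_functorM A B (G : dgfunctor A B) (x y z : A)
    (g : homology (dghom y z) 0) (f : homology (dghom x y) 0) :
  homology_map (dgfmor G x z) (H0_comp g f) =
  H0_comp (homology_map (dgfmor G y z) g) (homology_map (dgfmor G x y) f).
Proof.
rewrite -(hclassK g) -(hclassK f) !(H0_compE, homology_mapE).
by congr hclass; apply: val_inj; exact: dgfmorM.
Qed.

Definition H0_functor A B (G : dgfunctor A B) : functor (H0 A) (H0 B) :=
  @Functor (H0 A) (H0 B) (dgfob G)
    (fun x y => @homology_map k _ _ (dgfmor G x y) 0)
    (H0_functor1 G) (H0_functorM G).

Definition quasi_equivalence A B (G : dgfunctor A B) : Prop :=
  (forall x y : A, quasi_isomorphism (dgfmor G x y)) /\
  essentially_surjective (H0_functor G).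

Definition nonneg_complex (M : complex k) : Prop :=
  forall (n : int) (x : M n), n < 0 -> x = 0.

Definition nonneg_dgcat A : Prop :=
  forall x y : A, nonneg_complex (dghom x y).

Definition DGCAT_ge0 : category := full_subcategory (nonneg_dgcat : DGCAT -> Prop).

Definition dgcat_inclusion : functor DGCAT_ge0 DGCAT := full_inclusion _.

End DGCategory.

Definition lin (k : comPzRingType) (U V : lmodType k) (f : U -> V)
    (fl : linear f) : {linear U -> V} :=
  HB.pack f (GRing.isLinear.Build k U V *:%R f fl).

Section Truncation.
Variable k : comPzRingType.
Implicit Types (M N : complex k) (A B : dgcat k).

(* The three cases of the definition of the truncation are realised as
   submodules of [M n]: [0] for [n < 0], the kernel of the differential for
   [n = 0], and all of [M n] for [n >= 1]. *)
Definition trunc_pred M (n : int) : {pred M n} := fun x =>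
  if n < 0 then x == 0
  else if n == 0 then dif (int_pred1K n) x == 0
  else true.

Lemma trunc_submod_closed M n : submod_closed (@trunc_pred M n).
Proof.
split=> [|a x y]; rewrite !unfold_in /trunc_pred.
  by case: ifP => // _; case: ifP => // _; rewrite linear0.
case: ifP => [_ /eqP-> /eqP->|_]; first by rewrite scaler0 addr0.
case: ifP => // _ /eqP hx /eqP hy.
by rewrite linearP hx hy scaler0 addr0.
Qed.
HB.instance Definition _ M n :=
  GRing.isSubmodClosed.Build k (M n) (@trunc_pred M n) (trunc_submod_closed M n).

Lemma trunc_predP M n (x : M n) :
  reflect ((n < 0 -> x = 0) /\ (n = 0 -> forall m (e : n = m + 1), dif e x = 0))
          (x \in @trunc_pred M n).
Proof.
apply: (iffP idP); rewrite unfold_in /trunc_pred.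
  case: ltrgt0P => hn hx; split=> //.
  - by move=> h; rewrite h ltxx in hn.
  - by move=> _; apply/eqP.
  - by move=> h; rewrite h ltxx in hn.
  - move=> _ m e; apply: (cycleP (Submod (S := @cycle_pred k M n) (_ : x \in _))).
    by rewrite unfold_in.
case: ltrgt0P => // hn [h1 h2]; apply/eqP; first exact: h1.
exact: h2.
Qed.

Lemma trunc_dif_subproof M m n (e : m = n + 1) (x : submod (@trunc_pred M m)) :
  dif e (val x) \in @trunc_pred M n.
Proof.
apply/trunc_predP; split=> [n0|_ p e']; last exact: dif_dif.
have /trunc_predP[h1 h2] := valP x.
have : m <= 0 by rewrite e lezD1.
rewrite le_eqVlt => /orP[/eqP m0|m0]; first exact: h2.
by rewrite h1 // linear0.
Qed.

Definition trunc_dif M m n (e : m = n + 1) (x : submod (@trunc_pred M m)) :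
  submod (@trunc_pred M n) := Submod (trunc_dif_subproof e x).

Lemma trunc_dif_linear M m n (e : m = n + 1) : linear (@trunc_dif M m n e).
Proof. by move=> a x y; apply: val_inj; rewrite /= linearP. Qed.

Lemma trunc_dif_dif M m n p (e : m = n + 1) (e' : n = p + 1)
  (x : submod (@trunc_pred M m)) : trunc_dif e' (trunc_dif e x) = 0.
Proof. by apply: val_inj; exact: dif_dif. Qed.

Definition trunc M : complex k :=
  @Complex k (fun n => submod (@trunc_pred M n))
    (fun m n e => lin (@trunc_dif_linear M m n e)) (@trunc_dif_dif M).

Lemma trunc_map_subproof M N (f : chain_map M N) n (x : trunc M n) :
  f n (val x) \in @trunc_pred N n.
Proof.
have /trunc_predP[h1 h2] := valP x; apply/trunc_predP; split=> hn.
  by rewrite h1 // linear0.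
by move=> m e; rewrite -cmap_dif h2 // linear0.
Qed.

Definition trunc_map_fun M N (f : chain_map M N) n (x : trunc M n) : trunc N n :=
  Submod (trunc_map_subproof f x).

Lemma trunc_map_linear M N (f : chain_map M N) n : linear (@trunc_map_fun M N f n).
Proof. by move=> a x y; apply: val_inj; rewrite /= linearP. Qed.

Lemma trunc_map_dif M N (f : chain_map M N) m n (e : m = n + 1) (x : trunc M m) :
  trunc_map_fun f (dif e x) = dif e (trunc_map_fun f x).
Proof. by apply: val_inj; exact: cmap_dif. Qed.

Definition trunc_map M N (f : chain_map M N) : chain_map (trunc M) (trunc N) :=
  ChainMap (trunc_map_linear f) (trunc_map_dif f).

Lemma nonneg_trunc M : nonneg_complex (trunc M).
Proof.
by move=> n x hn; apply: val_inj; have /trunc_predP[h _] := valP x; exact: h.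
Qed.

Lemma trunc_comp_subproof A (x y z : A) m n p (e : m + n = p)
    (g : trunc (dghom y z) m) (f : trunc (dghom x y) n) :
  dgcomp e (val g) (val f) \in @trunc_pred (dghom x z) p.
Proof.
have /trunc_predP[g1 g2] := valP g; have /trunc_predP[f1 f2] := valP f.
have [m0|m0] := boolP (m < 0).
  by rewrite (g1 m0) dgcomp0f rpred0.
have [n0|n0] := boolP (n < 0).
  by rewrite (f1 n0) dgcompf0 rpred0.
rewrite -leNgt in m0; rewrite -leNgt in n0.
apply/trunc_predP; split=> [p0|p0 q e'].
  by have := addr_ge0 m0 n0; rewrite leNgt e p0.
have /eqP : m + n = 0 by rewrite e.
rewrite paddr_eq0 // => /andP[/eqP m0' /eqP n0'].
have el : m - 1 + n = q by rewrite addrAC e e' addrK.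
have er : m + (n - 1) = q by rewrite addrA e e' addrK.
rewrite (dgcomp_dif (int_pred1K m) (int_pred1K n) _ _ el er).
by rewrite g2 // f2 // dgcomp0f dgcompf0 scaler0 addr0.
Qed.

Definition trunc_comp A (x y z : A) m n p (e : m + n = p)
    (g : trunc (dghom y z) m) (f : trunc (dghom x y) n) : trunc (dghom x z) p :=
  Submod (trunc_comp_subproof e g f).

Lemma trunc_one_subproof A (x : A) : dgone x \in @trunc_pred (dghom x x) 0.
Proof. by apply/trunc_predP; split=> // _ m e; exact: dgone_dif. Qed.

Definition trunc_one A (x : A) : trunc (dghom x x) 0 :=
  Submod (trunc_one_subproof x).

Section TruncDGCat.
Variable A : dgcat k.

Lemma trunc_comp_linearl (x y z : A) m n p (e : m + n = p)
    (f : trunc (dghom x y) n) :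
  linear (fun g : trunc (dghom y z) m => trunc_comp e g f).
Proof.
move=> a g g'; apply: val_inj => /=.
exact: (dgcomp_linearl e (val f) a (val g) (val g')).
Qed.

Lemma trunc_comp_linearr (x y z : A) m n p (e : m + n = p)
    (g : trunc (dghom y z) m) :
  linear (fun f : trunc (dghom x y) n => trunc_comp e g f).
Proof.
move=> a f f'; apply: val_inj => /=.
exact: (dgcomp_linearr e (val g) a (val f) (val f')).
Qed.

Lemma trunc_comp_dif (x y z : A) (m n p m' n' p' : int)
    (em : m = m' + 1) (en : n = n' + 1) (ep : p = p' + 1)
    (e : m + n = p) (el : m' + n = p') (er : m + n' = p')
    (g : trunc (dghom y z) m) (f : trunc (dghom x y) n) :
  dif ep (trunc_comp e g f) =
    trunc_comp el (dif em g) f + (-1) ^+ `|m|%N *: trunc_comp er g (dif en f).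
Proof. by apply: val_inj; exact: dgcomp_dif. Qed.

Lemma trunc_one_dif (x : A) n (e : 0 = n + 1) : dif e (trunc_one x) = 0.
Proof. by apply: val_inj; exact: dgone_dif. Qed.

Lemma trunc_compA (x y z t : A) (m n p mn np q : int)
    (emn : m + n = mn) (enp : n + p = np) (e : m + np = q) (e' : mn + p = q)
    (h : trunc (dghom z t) m) (g : trunc (dghom y z) n) (f : trunc (dghom x y) p) :
  trunc_comp e h (trunc_comp enp g f) = trunc_comp e' (trunc_comp emn h g) f.
Proof. by apply: val_inj; exact: dgcompA. Qed.

Lemma trunc_comp1f (x y : A) n (e : 0 + n = n) (f : trunc (dghom x y) n) :
  trunc_comp e (trunc_one y) f = f.
Proof. by apply: val_inj; exact: dgcomp1f. Qed.

Lemma trunc_compf1 (x y : A) n (e : n + 0 = n) (f : trunc (dghom x y) n) :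
  trunc_comp e f (trunc_one x) = f.
Proof. by apply: val_inj; exact: dgcompf1. Qed.

Definition trunc_dgcat : dgcat k :=
  @DGCat k A (fun x y => trunc (dghom x y))
    (fun x y z m n p e g f => trunc_comp e g f) (@trunc_one A)
    trunc_comp_linearl trunc_comp_linearr trunc_comp_dif trunc_one_dif
    trunc_compA trunc_comp1f trunc_compf1.

Lemma nonneg_trunc_dgcat : nonneg_dgcat trunc_dgcat.
Proof. by move=> x y; exact: nonneg_trunc. Qed.
End TruncDGCat.

Section TruncDGFunctor.
Variables (A B : dgcat k) (G : dgfunctor A B).

Lemma trunc_dgfunctorM (x y z : trunc_dgcat A) m n p (e : m + n = p)
    (g : dghom y z m) (f : dghom x y n) :
  trunc_map (dgfmor G x z) p (dgcomp e g f) =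
  dgcomp (d := trunc_dgcat B) e (trunc_map (dgfmor G y z) m g)
    (trunc_map (dgfmor G x y) n f).
Proof. by apply: val_inj; exact: dgfmorM. Qed.

Lemma trunc_dgfunctor1 (x : trunc_dgcat A) :
  trunc_map (dgfmor G x x) 0 (dgone x) = dgone (d := trunc_dgcat B) (G x).
Proof. by apply: val_inj; exact: dgfmor1. Qed.

Definition trunc_dgfunctor : dgfunctor (trunc_dgcat A) (trunc_dgcat B) :=
  @DGFunctor k (trunc_dgcat A) (trunc_dgcat B) (dgfob G)
    (fun x y => trunc_map (dgfmor G x y)) trunc_dgfunctorM trunc_dgfunctor1.
End TruncDGFunctor.

Definition truncation_ob (A : DGCAT k) : DGCAT_ge0 k :=
  exist _ (trunc_dgcat A) (@nonneg_trunc_dgcat A).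

Lemma truncation1 (A : DGCAT k) :
  trunc_dgfunctor (dgfunctor_id A) = dgfunctor_id (trunc_dgcat A).
Proof.
unshelve refine (dgfunctor_eq (e := _) _) => // x y.
by apply: chain_map_eq => n f; exact: val_inj.
Qed.

Lemma truncationM (A B C : DGCAT k) (G : dgfunctor B C) (F : dgfunctor A B) :
  trunc_dgfunctor (dgfunctor_comp G F) =
  dgfunctor_comp (trunc_dgfunctor G) (trunc_dgfunctor F).
Proof.
unshelve refine (dgfunctor_eq (e := _) _) => // x y.
by apply: chain_map_eq => n f; exact: val_inj.
Qed.

Definition truncation : functor (DGCAT k) (DGCAT_ge0 k) :=
  @Functor (DGCAT k) (DGCAT_ge0 k) truncation_ob
    (fun A B G => trunc_dgfunctor G) truncation1 truncationM.

Definition trunc_val M : chain_map (trunc M) M :=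
  @ChainMap k (trunc M) M (fun n x => val x) (fun n a x y => erefl)
    (fun m n e x => erefl).

Definition trunc_counit A : dgfunctor (trunc_dgcat A) A :=
  @DGFunctor k (trunc_dgcat A) A (fun x => x) (fun x y : A => trunc_val (@dghom k A x y))
    (fun x y z m n p e g f => erefl) (fun x => erefl).

Section Unit.
Variables (A : dgcat k) (hA : nonneg_dgcat A).

Lemma trunc_unit_subproof (x y : A) n (f : dghom x y n) :
  f \in @trunc_pred (dghom x y) n.
Proof.
apply/trunc_predP; split=> [|n0 m e]; first exact: hA.
by apply: hA; rewrite -[m](addrK 1) -e n0.
Qed.

Definition trunc_unit_fun (x y : A) n (f : dghom x y n) : trunc (dghom x y) n :=
  Submod (trunc_unit_subproof f).

Lemma trunc_unit_linear (x y : A) n : linear (@trunc_unit_fun x y n).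
Proof. by move=> a f g; exact: val_inj. Qed.

Lemma trunc_unit_dif (x y : A) m n (e : m = n + 1) (f : dghom x y m) :
  trunc_unit_fun (dif e f) = dif e (trunc_unit_fun f).
Proof. exact: val_inj. Qed.

Definition trunc_unit_map (x y : A) : chain_map (dghom x y) (trunc (dghom x y)) :=
  ChainMap (@trunc_unit_linear x y) (@trunc_unit_dif x y).

Lemma trunc_unitM (x y z : A) m n p (e : m + n = p)
    (g : dghom y z m) (f : dghom x y n) :
  trunc_unit_map x z p (dgcomp e g f) =
  dgcomp (d := trunc_dgcat A) e (trunc_unit_map y z m g) (trunc_unit_map x y n f).
Proof. exact: val_inj. Qed.

Lemma trunc_unit1 (x : A) :
  trunc_unit_map x x 0 (dgone x) = dgone (d := trunc_dgcat A) x.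
Proof. exact: val_inj. Qed.

Definition trunc_unit : dgfunctor A (trunc_dgcat A) :=
  @DGFunctor k A (trunc_dgcat A) (fun x => x) trunc_unit_map trunc_unitM trunc_unit1.
End Unit.

Lemma trunc_unit_nat (A B : DGCAT_ge0 k) (G : dgfunctor (sval A) (sval B)) :
  dgfunctor_comp (trunc_unit (svalP B)) G =
  dgfunctor_comp (trunc_dgfunctor G) (trunc_unit (svalP A)).
Proof.
unshelve refine (dgfunctor_eq (e := _) _) => // x y.
by apply: chain_map_eq => n f; exact: val_inj.
Qed.

Lemma trunc_counit_nat (A B : DGCAT k) (G : dgfunctor A B) :
  dgfunctor_comp G (trunc_counit A) =
  dgfunctor_comp (trunc_counit B) (trunc_dgfunctor G).
Proof. by unshelve refine (dgfunctor_eq (e := _) _) => // x y; exact: chain_map_eq. Qed.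

Lemma trunc_triL (A : DGCAT_ge0 k) :
  dgfunctor_comp (trunc_counit (sval A)) (trunc_unit (svalP A)) =
  dgfunctor_id (sval A).
Proof. by unshelve refine (dgfunctor_eq (e := _) _) => // x y; exact: chain_map_eq. Qed.

Lemma trunc_triR (A : DGCAT k) :
  dgfunctor_comp (trunc_dgfunctor (trunc_counit A))
    (trunc_unit (svalP (truncation_ob A))) = dgfunctor_id (trunc_dgcat A).
Proof.
unshelve refine (dgfunctor_eq (e := _) _) => // x y.
by apply: chain_map_eq => n f; exact: val_inj.
Qed.

Definition inclusion_truncation_adjunction :
  adjunction (dgcat_inclusion k) truncation :=
  @Adjunction (DGCAT_ge0 k) (DGCAT k) (dgcat_inclusion k) truncation
    (fun A : DGCAT_ge0 k => trunc_unit (svalP A)) (fun A : DGCAT k => trunc_counit A)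
    trunc_unit_nat trunc_counit_nat trunc_triL trunc_triR.
End Truncation.

Section Spheres.
Variable k : comPzRingType.
Implicit Types M N : complex k.

Lemma lin0_subproof (U V : lmodType k) : linear (fun _ : U => 0 : V).
Proof. by move=> a x y; rewrite scaler0 addr0. Qed.

Definition zero_complex : complex k :=
  @Complex k (fun n => 'rV[k]_0) (fun m n e => lin (@lin0_subproof _ _))
    (fun m n p e e' x => erefl).

Lemma zero_complex_eq n (x y : zero_complex n) : x = y.
Proof. by rewrite (thinmx0 x) (thinmx0 y). Qed.

Definition zero_map M : chain_map zero_complex M :=
  @ChainMap k zero_complex M (fun n x => 0) (fun n => @lin0_subproof _ _)
    (fun m n e x => esym (linear0 (dif e))).

Lemma nonneg_zero_complex : nonneg_complex zero_complex.
Proof. by move=> n x _; exact: zero_complex_eq. Qed.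

(* [k[i]], that is [k] in degree [i] and [0] elsewhere, realised in degree [m]
   as the submodule of [k] that is everything if [m = i] and [0] otherwise. *)
Definition sphere_pred (i m : int) : {pred k^o} :=
  fun a => (m != i) ==> (a == 0).

Lemma sphere_submod_closed i m : submod_closed (sphere_pred i m).
Proof.
split=> [|c x y]; rewrite !unfold_in /sphere_pred; first by rewrite eqxx implybT.
by case: (m == i) => //= /eqP-> /eqP->; rewrite scaler0 addr0.
Qed.
HB.instance Definition _ i m :=
  GRing.isSubmodClosed.Build k k^o (sphere_pred i m) (sphere_submod_closed i m).

Definition sphere (i : int) : complex k :=
  @Complex k (fun m => submod (sphere_pred i m))
    (fun m n e => lin (@lin0_subproof _ _)) (fun m n p e e' x => erefl).

Lemma sphere_eq0 i m (a : sphere i m) : m != i -> a = 0.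
Proof.
by move=> mi; apply: val_inj; have := valP a; rewrite unfold_in /sphere_pred mi => /eqP.
Qed.

Lemma nonneg_sphere i : 0 <= i -> nonneg_complex (sphere i).
Proof. by move=> i0 n x n0; apply: sphere_eq0; rewrite lt_eqF // (lt_le_trans n0). Qed.

Lemma sphere_gen_subproof i : (1 : k^o) \in sphere_pred i i.
Proof. by rewrite unfold_in /sphere_pred eqxx. Qed.

Definition sphere_gen i : sphere i i := Submod (sphere_gen_subproof i).

Lemma dif_cast (P : complex k) (a b c d : int) (i : a = b) (j : c = d)
  (e : b = d + 1) (e' : a = c + 1) (x : P a) : dif e (cast i x) = cast j (dif e' x).
Proof. by subst b d; rewrite !castE; exact: dif_irr. Qed.

Section Cone.
Variables (M N : complex k) (f : chain_map M N).

(* Degree [m] of the cone of [f] is [M_(m-1) + N_m], with differential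
   [(x, y) |-> (- d x, f x + d y)]; [cast] identifies [N_(m-1)] with [N_n] when
   [m = n + 1]. *)
Lemma cone_index (m n : int) (e : m = n + 1) : m - 1 = n - 1 + 1.
Proof. by rewrite e addrK subrK. Qed.

Lemma cone_index' (m n : int) (e : m = n + 1) : m - 1 = n.
Proof. by rewrite e addrK. Qed.

Definition cone_dif (m n : int) (e : m = n + 1) (z : (M (m - 1)%R * N m)%type) :
    (M (n - 1)%R * N n)%type :=
  (- dif (cone_index e) z.1, cast (cone_index' e) (f _ z.1) + dif e z.2).

Lemma cone_dif_linear m n (e : m = n + 1) : linear (@cone_dif m n e).
Proof.
move=> a [x y] [x' y']; rewrite /cone_dif /=; congr (_, _).
  by rewrite linearP opprD -scalerN.
by rewrite !linearP /= scalerDr addrACA.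
Qed.

Lemma cone_dif_dif m n p (e : m = n + 1) (e' : n = p + 1) z :
  cone_dif e' (cone_dif e z) = 0.
Proof.
case: z => x y; rewrite /cone_dif /=; congr (_, _).
  by rewrite linearN dif_dif !oppr0.
rewrite !linearD /= dif_dif addr0 !linearN /= cmap_dif.
by rewrite (dif_cast _ (cone_index' e') _ (cone_index e)) addNr.
Qed.

Definition cone : complex k :=
  @Complex k (fun m => (M (m - 1)%R * N m)%type)
    (fun m n e => lin (@cone_dif_linear m n e)) cone_dif_dif.

Definition cone_incl_fun m (y : N m) : cone m := (0, y).

Lemma cone_incl_linear m : linear (@cone_incl_fun m).
Proof. by move=> a x y; congr (_, _); rewrite /= scaler0 addr0. Qed.

Lemma cone_incl_dif m n (e : m = n + 1) (y : N m) :
  cone_incl_fun (dif e y) = dif e (cone_incl_fun y).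
Proof. by congr (_, _); rewrite /= !linear0 ?oppr0 ?add0r. Qed.

Definition cone_incl : chain_map N cone := ChainMap cone_incl_linear cone_incl_dif.

Lemma nonneg_cone : nonneg_complex M -> nonneg_complex N -> nonneg_complex cone.
Proof.
move=> hM hN n [x y] n0; congr (_, _); last exact: hN.
by apply: hM; rewrite (le_lt_trans _ n0) // gerBl.
Qed.
End Cone.

Definition disk (n : int) : complex k := cone (chain_id (sphere (n - 1))).

Definition sphere_disk (n : int) : chain_map (sphere (n - 1)) (disk n) :=
  cone_incl (chain_id (sphere (n - 1))).

(* The canonical isomorphism [k (x) M = M], where [k] sits in degree [0]. *)
Lemma lact_index (m n p : int) (e : m + n = p) (e0 : m = 0) : n = p.
Proof. by rewrite -e e0 add0r. Qed.

Definition lact M (m n p : int) (e : m + n = p) (a : sphere 0 m) (x : M n) : M p :=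
  match m =P 0 with
  | ReflectT e0 => val a *: cast (lact_index e e0) x
  | ReflectF _ => 0
  end.

Lemma lactE M n p (e : 0 + n = p) (e' : n = p) (a : sphere 0 0) (x : M n) :
  lact e a x = val a *: cast e' x.
Proof.
by rewrite /lact; case: eqP => // e0; rewrite (eq_irrelevance (lact_index e e0) e').
Qed.

Lemma lactE0 M n (e : 0 + n = n) (a : sphere 0 0) (x : M n) :
  lact e a x = val a *: x.
Proof. by rewrite (lactE e erefl) castE. Qed.

Lemma lact_out M m n p (e : m + n = p) (a : sphere 0 m) (x : M n) :
  m != 0 -> lact e a x = 0.
Proof. by rewrite /lact; case: eqP. Qed.

Lemma lact_linearl M m n p (e : m + n = p) (x : M n) :
  linear (fun a : sphere 0 m => lact e a x).
Proof.
have [m0|m0] := eqVneq m 0; last by move=> c a b; rewrite !lact_out // scaler0 addr0.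
move=> c a b; subst m; have e' : n = p by rewrite -e add0r.
by rewrite !(lactE e e') /= scalerDl scalerA.
Qed.

Lemma lact_linearr M m n p (e : m + n = p) (a : sphere 0 m) :
  linear (fun x : M n => lact e a x).
Proof.
have [m0|m0] := eqVneq m 0; last by move=> c x y; rewrite !lact_out // scaler0 addr0.
move=> c x y; subst m; have e' : n = p by rewrite -e add0r.
by rewrite !(lactE e e') linearP scalerDr !scalerA mulrC.
Qed.

Lemma lact0l M m n p (e : m + n = p) (x : M n) : lact e (0 : sphere 0 m) x = 0.
Proof.
have := lact_linearl e x 1 0 0 => /=; rewrite scale1r addr0.
by move/(congr1 (fun z => z - lact e 0 x)); rewrite scale1r addrK subrr.
Qed.

Lemma lact0r M m n p (e : m + n = p) (a : sphere 0 m) : lact e a (0 : M n) = 0.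
Proof.
have := lact_linearr e a 1 (0 : M n) 0 => /=; rewrite scale1r addr0.
by move/(congr1 (fun z => z - lact e a 0)); rewrite scale1r addrK subrr.
Qed.

Lemma lact1 M n (e : 0 + n = n) (x : M n) : lact e (sphere_gen 0) x = x.
Proof. by rewrite lactE0 scale1r. Qed.

Lemma lact_dif M m n p n' p' (e : m + n = p) (e' : m + n' = p')
    (en : n = n' + 1) (ep : p = p' + 1) (a : sphere 0 m) (x : M n) :
  dif ep (lact e a x) = lact e' a (dif en x).
Proof.
have [m0|m0] := eqVneq m 0; last by rewrite !lact_out // linear0.
subst m; have ex : n = p by rewrite -e add0r.
have ex' : n' = p' by rewrite -e' add0r.
by rewrite (lactE e ex) (lactE e' ex') linearZ /= (dif_cast ex ex' ep en).
Qed.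

Lemma lactA M m n p mn np q (emn : m + n = mn) (enp : n + p = np)
    (e : m + np = q) (e' : mn + p = q) (a : sphere 0 m) (b : sphere 0 n) (x : M p) :
  lact e a (lact enp b x) = lact e' (lact emn a b) x.
Proof.
have [m0|m0] := eqVneq m 0; last by rewrite (lact_out e) // (lact_out emn) // lact0l.
have [n0|n0] := eqVneq n 0; last first.
  by rewrite (lact_out enp) // (sphere_eq0 b n0) !lact0r lact0l.
subst m n; have E : 0 = mn by rewrite -emn addr0.
have E1 : p = np by rewrite -enp add0r.
have E2 : p = q by rewrite -e -E1 add0r.
case: mn / E emn e' => emn e'; case: np / E1 enp e => enp e.
case: q / E2 e e' => e e'; rewrite !lactE0; exact: scalerA.
Qed.

Lemma lactC m n p (e : m + n = p) (e' : n + m = p) (a : sphere 0 m) (b : sphere 0 n) :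
  lact e a b = lact e' b a.
Proof.
have [m0|m0] := eqVneq m 0; last first.
  by rewrite (lact_out e) // (sphere_eq0 a m0) lact0r.
have [n0|n0] := eqVneq n 0; last first.
  by rewrite (lact_out e') // (sphere_eq0 b n0) lact0r.
subst m n; have E : 0 = p by rewrite -e addr0.
case: p / E e e' => e e'; rewrite !lactE0; apply: val_inj.
exact: mulrC.
Qed.

Lemma lact_map M N (f : chain_map M N) m n p (e : m + n = p) (a : sphere 0 m) (x : M n) :
  f p (lact e a x) = lact e a (f n x).
Proof.
have [m0|m0] := eqVneq m 0; last by rewrite !lact_out // linear0.
subst m; have ex : n = p by rewrite -e add0r.
by case: p / ex e => e; rewrite !lactE0 linearZ.
Qed.
End Spheres.

Section StandardDGCats.
Variable k : comPzRingType.

Definition empty_dgcat : dgcat k.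
Proof.
by unshelve refine (@DGCat k void (fun x => match x with end)
  (fun x => match x with end) (fun x => match x with end) _ _ _ _ _ _ _) => - [].
Defined.

Definition empty_dgfunctor (A : dgcat k) : dgfunctor empty_dgcat A.
Proof.
by unshelve refine (@DGFunctor k empty_dgcat A (fun x => match x with end)
  (fun x => match x with end) _ _) => - [].
Defined.

Lemma nonneg_empty_dgcat : nonneg_dgcat empty_dgcat.
Proof. by case. Qed.

Lemma lact_sphere_dif (m n p m' n' p' : int)
    (em : m = m' + 1) (en : n = n' + 1) (ep : p = p' + 1)
    (e : m + n = p) (el : m' + n = p') (er : m + n' = p') M
    (g : sphere k 0 m) (f : cx M n) :
  dif ep (lact e g f) =
    lact el (dif em g) f + (-1) ^+ `|m|%N *: lact er g (dif en f).
Proof.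
rewrite [dif em g]/= lact0l add0r (lact_dif e er en).
have [m0|m0] := eqVneq m 0; last by rewrite !lact_out // scaler0.
by rewrite [absz m](_ : _ = 0%N) ?m0 // expr0 scale1r.
Qed.

Lemma lact_genr n (e : n + 0 = n) (f : sphere k 0 n) : lact e f (sphere_gen k 0) = f.
Proof. by rewrite (lactC e (add0r n)) lact1. Qed.

Definition unit_dgcat : dgcat k :=
  @DGCat k unit (fun _ _ => sphere k 0) (fun _ _ _ m n p e g f => lact e g f)
    (fun _ => sphere_gen k 0)
    (fun _ _ _ m n p e f => lact_linearl e f)
    (fun _ _ _ m n p e g => lact_linearr e g)
    (fun _ _ _ m n p m' n' p' em en ep e el er g f =>
       lact_sphere_dif em en ep e el er g f)
    (fun _ n e => erefl)
    (fun _ _ _ _ m n p mn np q emn enp e e' h g f => lactA emn enp e e' h g f)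
    (fun _ _ n e f => lact1 e f) (fun _ _ n e f => lact_genr e f).

Lemma nonneg_unit_dgcat : nonneg_dgcat unit_dgcat.
Proof. by move=> x y; exact: nonneg_sphere. Qed.

(* The dg functor out of [\underline{k}] determined by an object [x]: a scalar
   is sent to the corresponding multiple of the identity of [x]. *)
Section UnitFunctor.
Variables (A : dgcat k) (x : A).

Definition unit_map_fun n (a : sphere k 0 n) : dghom x x n :=
  lact (addr0 n) a (dgone x).

Lemma unit_map_dif m n (e : m = n + 1) (a : sphere k 0 m) :
  unit_map_fun (dif e a) = dif e (unit_map_fun a).
Proof.
rewrite [dif e a]/= /unit_map_fun lact0l.
have [m0|m0] := eqVneq m 0; last by rewrite lact_out // linear0.
move/esym: m0 => m0; case: m / m0 e a => e a.
by rewrite lactE0 linearZ /= dgone_dif scaler0.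
Qed.

Definition unit_map : chain_map (sphere k 0) (dghom x x) :=
  @ChainMap k (sphere k 0) (dghom x x) unit_map_fun
    (fun n => lact_linearl (addr0 n) (dgone x)) unit_map_dif.

Lemma unit_dgfunctorM (m n p : int) (e : m + n = p) (g : sphere k 0 m)
    (f : sphere k 0 n) :
  unit_map p (lact e g f) = dgcomp e (unit_map m g) (unit_map n f).
Proof.
rewrite /= /unit_map_fun.
have [m0|m0] := eqVneq m 0; last first.
  by rewrite !(lact_out _ g) // lact0l dgcomp0f.
have [n0|n0] := eqVneq n 0; last first.
  by rewrite (sphere_eq0 f n0) lact0r !lact0l dgcompf0.
subst m n; have E : 0 = p by rewrite -e addr0.
case: p / E e => e; rewrite !lactE0 /=.
have := dgcomp_linearl e (val f *: dgone x) (val g) (dgone x) 0.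
rewrite /= !addr0 => ->.
by rewrite dgcomp0f addr0 dgcomp1f scalerA.
Qed.

Lemma unit_dgfunctor1 : unit_map 0 (sphere_gen k 0) = dgone x.
Proof. by rewrite /= /unit_map_fun lact1. Qed.

Definition unit_dgfunctor : dgfunctor unit_dgcat A :=
  @DGFunctor k unit_dgcat A (fun _ => x) (fun _ _ => unit_map)
    (fun _ _ _ => unit_dgfunctorM) (fun _ => unit_dgfunctor1).
End UnitFunctor.

(* [arrow_dgcat M] has the objects [false] and [true], endomorphisms [k],
   the complex [M] from [false] to [true], and [0] from [true] to [false]. *)
Section Arrow.
Variable M : complex k.

Definition arrow_hom (x y : bool) : complex k :=
  match x, y with
  | false, true => M
  | true, false => zero_complex k
  | _, _ => sphere k 0
  end.

Lemma addC_index (m n p : int) (e : m + n = p) : n + m = p.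
Proof. by rewrite addrC. Qed.

Definition arrow_comp (x y z : bool) (m n p : int) (e : m + n = p) :
    arrow_hom y z m -> arrow_hom x y n -> arrow_hom x z p :=
  match x, y, z return arrow_hom y z m -> arrow_hom x y n -> arrow_hom x z p with
  | false, false, false => fun g f => lact e g f
  | true, true, true => fun g f => lact e g f
  | false, true, true => fun g f => lact e g f
  | false, false, true => fun g f => lact (addC_index e) f g
  | _, _, _ => fun _ _ => 0
  end.

Definition arrow_one (x : bool) : arrow_hom x x 0 :=
  match x with false => sphere_gen k 0 | true => sphere_gen k 0 end.

Lemma arrow_comp_linearl (x y z : bool) m n p (e : m + n = p) (f : arrow_hom x y n) :
  linear (fun g : arrow_hom y z m => arrow_comp e g f).
Proof.
case: x y z f => [] [] [] f; try exact: lact_linearl; try exact: lin0_subproof.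
exact: lact_linearr.
Qed.

Lemma arrow_comp_linearr (x y z : bool) m n p (e : m + n = p) (g : arrow_hom y z m) :
  linear (fun f : arrow_hom x y n => arrow_comp e g f).
Proof.
case: x y z g => [] [] [] g; try exact: lact_linearr; try exact: lin0_subproof.
exact: lact_linearl.
Qed.

Lemma arrow_comp_dif (x y z : bool) (m n p m' n' p' : int)
    (em : m = m' + 1) (en : n = n' + 1) (ep : p = p' + 1)
    (e : m + n = p) (el : m' + n = p') (er : m + n' = p')
    (g : arrow_hom y z m) (f : arrow_hom x y n) :
  dif ep (arrow_comp e g f) =
    arrow_comp el (dif em g) f + (-1) ^+ `|m|%N *: arrow_comp er g (dif en f).
Proof.
case: x y z g f => [] [] [] g f; try exact: lact_sphere_dif;
  try by rewrite /= scaler0 addr0 ?linear0.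
rewrite /= lact0l scaler0 addr0.
by rewrite (lact_dif (addC_index e) (addC_index el) em).
Qed.

Lemma arrow_one_dif (x : bool) n (e : 0 = n + 1) : dif e (arrow_one x) = 0.
Proof. by case: x. Qed.

Lemma arrow_compA (x y z t : bool) (m n p mn np q : int)
    (emn : m + n = mn) (enp : n + p = np) (e : m + np = q) (e' : mn + p = q)
    (h : arrow_hom z t m) (g : arrow_hom y z n) (f : arrow_hom x y p) :
  arrow_comp e h (arrow_comp enp g f) = arrow_comp e' (arrow_comp emn h g) f.
Proof.
case: x y z t h g f => [] [] [] [] h g f /=; rewrite ?lact0l ?lact0r //;
  try exact: lactA; try exact: (@lactA k (sphere k 0)).
- have e2 : m + p + n = q by rewrite -e -enp addrA addrAC.
  rewrite (lactA (erefl (m + p)) (addC_index enp) e e2).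
  rewrite (lactA (addrC p m) emn (addC_index e') e2).
  by rewrite (lactC (addrC p m) erefl).
- by rewrite (lactA (addC_index enp) (addC_index emn) (addC_index e') (addC_index e))
    (lactC (addC_index enp) enp).
Qed.

Lemma arrow_comp1f (x y : bool) n (e : 0 + n = n) (f : arrow_hom x y n) :
  arrow_comp e (arrow_one y) f = f.
Proof.
case: x y f => [] [] f; try exact: lact1; try exact: zero_complex_eq.
Qed.

Lemma arrow_compf1 (x y : bool) n (e : n + 0 = n) (f : arrow_hom x y n) :
  arrow_comp e f (arrow_one x) = f.
Proof.
case: x y f => [] [] f; try exact: lact_genr; try exact: zero_complex_eq.
exact: lact1.
Qed.

Definition arrow_dgcat : dgcat k :=
  DGCat arrow_comp_linearl arrow_comp_linearr arrow_comp_dif arrow_one_dif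
    arrow_compA arrow_comp1f arrow_compf1.

Lemma nonneg_arrow_dgcat : nonneg_complex M -> nonneg_dgcat arrow_dgcat.
Proof.
by move=> hM [] []; [exact: nonneg_sphere | exact: nonneg_zero_complex
  | exact: hM | exact: nonneg_sphere].
Qed.
End Arrow.

Section ArrowFunctor.
Variables (M N : complex k) (f : chain_map M N).

Definition arrow_map (x y : bool) : chain_map (arrow_hom M x y) (arrow_hom N x y) :=
  match x, y with
  | false, true => f
  | true, false => chain_id (zero_complex k)
  | false, false | true, true => chain_id (sphere k 0)
  end.

Lemma arrow_mapM (x y z : bool) m n p (e : m + n = p) (b : arrow_hom M y z m)
    (a : arrow_hom M x y n) :
  arrow_map x z p (arrow_comp e b a) =
  arrow_comp e (arrow_map y z m b) (arrow_map x y n a).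
Proof. by case: x y z b a => [] [] [] b a //=; rewrite ?lact_map ?linear0. Qed.

Lemma arrow_map1 (x : bool) : arrow_map x x 0 (arrow_one M x) = arrow_one N x.
Proof. by case: x. Qed.

Definition arrow_dgfunctor : dgfunctor (arrow_dgcat M) (arrow_dgcat N) :=
  @DGFunctor k (arrow_dgcat M) (arrow_dgcat N) (fun x => x) arrow_map
    arrow_mapM arrow_map1.
End ArrowFunctor.
End StandardDGCats.

Inductive kgen := gf | gg | gr1 | gr2 | gr12.

Definition kgen_code (a : kgen) : nat :=
  match a with gf => 0 | gg => 1 | gr1 => 2 | gr2 => 3 | gr12 => 4 end.
Definition kgen_decode (n : nat) : option kgen :=
  nth None [:: Some gf; Some gg; Some gr1; Some gr2; Some gr12] n.
Lemma kgen_codeK : pcancel kgen_code kgen_decode. Proof. by case. Qed.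
HB.instance Definition _ := Countable.copy kgen (pcan_type kgen_codeK).

(* The objects [1] and [2] of [K] are [false] and [true]. *)
Definition ksrc (a : kgen) : bool :=
  match a with gf | gr1 | gr12 => false | gg | gr2 => true end.
Definition ktgt (a : kgen) : bool :=
  match a with gg | gr1 => false | gf | gr2 | gr12 => true end.
Definition kgdeg (a : kgen) : nat :=
  match a with gf | gg => 0 | gr1 | gr2 => 1 | gr12 => 2 end.

(* A word [[:: a1; ...; ar]] stands for the composite [a1 o ... o ar]. *)
Fixpoint kpath (x y : bool) (w : seq kgen) : bool :=
  if w is a :: w' then (ktgt a == y) && kpath x (ksrc a) w' else x == y.

Definition kdeg (w : seq kgen) : nat := sumn (map kgdeg w).

Lemma kpath_cat x y z u v : kpath y z u -> kpath x y v -> kpath x z (u ++ v).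
Proof.
by elim: u z => [|a u IH] z /= => [/eqP<-|/andP[-> /IH h] /h].
Qed.

Lemma kdeg_cat u v : kdeg (u ++ v) = (kdeg u + kdeg v)%N.
Proof. by rewrite /kdeg map_cat sumn_cat. Qed.

Section WordAlgebra.
Variable k : comPzRingType.

(* The free (non-commutative) [k]-algebra on the generators of [K], in which the
   morphisms [x -> y] of degree [n] are the elements supported on composable
   words from [x] to [y] of degree [n] (see [khom_pred]).  The library provides
   the module structure of [{malg k[_]}] for nonzero [k] only. *)
Definition kalg := {malg k[seq kgen]}.
HB.instance Definition _ := GRing.Zmodule.on kalg.

Definition kalg_scale (c : k) (a : kalg) : kalg :=
  [malg w in msupp a => c * a@_w].

Lemma kalg_scaleE c a w : (kalg_scale c a)@_w = c * a@_w.
Proof. by rewrite mcoeffE; case: msuppP => // _; rewrite mulr0. Qed.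

Lemma kalg_scaleA c d a : kalg_scale c (kalg_scale d a) = kalg_scale (c * d) a.
Proof. by apply/malgP => w; rewrite !kalg_scaleE mulrA. Qed.
Lemma kalg_scale1 : left_id 1 kalg_scale.
Proof. by move=> a; apply/malgP => w; rewrite kalg_scaleE mul1r. Qed.
Lemma kalg_scaleDr : right_distributive kalg_scale +%R.
Proof.
by move=> c a b; apply/malgP => w; rewrite !(mcoeffD, kalg_scaleE) mulrDr.
Qed.
Lemma kalg_scaleDl a : {morph kalg_scale^~ a : c d / c + d}.
Proof.
by move=> c d; apply/malgP => w; rewrite !(mcoeffD, kalg_scaleE) mulrDl.
Qed.
HB.instance Definition _ := GRing.Zmodule_isLmodule.Build k kalg
  kalg_scaleA kalg_scale1 kalg_scaleDr kalg_scaleDl.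

Definition kword (w : seq kgen) : kalg := << 1 *g w >>.

Lemma kalgE (a : kalg) : a = \sum_(w <- msupp a) a@_w *: kword w.
Proof.
rewrite {1}[a]monalgE; apply: eq_bigr => w _; apply/malgP => v.
by rewrite kalg_scaleE !mcoeffU mulr_natr.
Qed.

Definition kext (V : lmodType k) (h : seq kgen -> V) (a : kalg) : V :=
  \sum_(w <- msupp a) a@_w *: h w.

Lemma kextEw (V : lmodType k) (h : seq kgen -> V) (a : kalg) (D : {fset seq kgen}) :
  (msupp a `<=` D)%fset -> kext h a = \sum_(w <- D) a@_w *: h w.
Proof.
move=> /fsubsetP sD; rewrite /kext [RHS](big_fsetID _ (mem (msupp a))) /=.
rewrite [X in _ + X]big1_fset ?addr0; last first.
  move=> w; rewrite !inE /= => /andP[_ wa] _.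
  by rewrite (mcoeff_outdom wa) scale0r.
apply: eq_fbigl => w; rewrite !inE /=.
by case: (boolP (w \in msupp a)) => [/sD->|]; rewrite ?andbF.
Qed.

Lemma kext_linear (V : lmodType k) (h : seq kgen -> V) : linear (kext h).
Proof.
move=> c a b; pose D := (msupp (c *: a + b) `|` (msupp a `|` msupp b))%fset.
rewrite (@kextEw _ _ _ D); last exact: fsubsetUl.
rewrite (@kextEw _ _ a D); last by rewrite /D fsetUCA fsubsetUl.
rewrite (@kextEw _ _ b D); last by rewrite /D fsetUA fsubsetUr.
rewrite scaler_sumr -big_split /=; apply: eq_bigr => w _.
by rewrite mcoeffD kalg_scaleE scalerDl scalerA.
Qed.
HB.instance Definition _ (V : lmodType k) (h : seq kgen -> V) :=
  GRing.isLinear.Build k kalg V *:%R (kext h) (kext_linear h).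

Lemma kext_word (V : lmodType k) (h : seq kgen -> V) w : kext h (kword w) = h w.
Proof.
rewrite (@kextEw _ _ _ [fset w]%fset) ?msuppU_le //.
by rewrite big_seq_fset1 mcoeffUU scale1r.
Qed.

Lemma kalg_linear_eq (V : lmodType k) (f g : kalg -> V) :
  linear f -> linear g -> (forall w, f (kword w) = g (kword w)) -> f =1 g.
Proof.
move=> fl gl fg a; rewrite (kalgE a).
have -> : f = lin fl by []. have -> : g = lin gl by [].
by rewrite !linear_sum; apply: eq_bigr => w _; rewrite !linearZ /= fg.
Qed.

Definition kmul (a b : kalg) : kalg :=
  kext (fun u => kext (fun v => kword (u ++ v)) b) a.

Lemma kmul_linearl b : linear (kmul^~ b).
Proof. exact: kext_linear. Qed.

Lemma kmul_linearr a : linear (kmul a).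
Proof.
move=> c b b'; rewrite /kmul /kext scaler_sumr -big_split /=.
apply: eq_bigr => w _; rewrite -!/(kext _ _) kext_linear scalerDr !scalerA.
by rewrite mulrC.
Qed.

Lemma kmul_word u v : kmul (kword u) (kword v) = kword (u ++ v).
Proof. by rewrite /kmul !kext_word. Qed.

Lemma kmulA : associative kmul.
Proof.
move=> a b c; move: a; apply: kalg_linear_eq => [z a a'|z a a'|u].
- by rewrite kmul_linearl.
- by rewrite !kmul_linearl.
move: b; apply: kalg_linear_eq => [z b b'|z b b'|v].
- by rewrite kmul_linearl kmul_linearr.
- by rewrite kmul_linearr kmul_linearl.
move: c; apply: kalg_linear_eq => [z c c'|z c c'|w].
- by rewrite !kmul_linearr.
- by rewrite kmul_linearr.
by rewrite !kmul_word catA.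
Qed.

Lemma kmul1 : left_id (kword [::]) kmul.
Proof.
apply: kalg_linear_eq => [z c c'|z c c'|w] //; first by rewrite kmul_linearr.
by rewrite kmul_word.
Qed.

Lemma kmulr1 : right_id (kword [::]) kmul.
Proof.
apply: kalg_linear_eq => [z c c'|z c c'|w] //; first by rewrite kmul_linearl.
by rewrite kmul_word cats0.
Qed.

Lemma kmulDl : left_distributive kmul +%R.
Proof. by move=> a b c; have := kmul_linearl c 1 a b; rewrite !scale1r. Qed.

Lemma kmulDr : right_distributive kmul +%R.
Proof. by move=> a b c; have := kmul_linearr a 1 b c; rewrite !scale1r. Qed.

HB.instance Definition _ := GRing.Zmodule_isPzRing.Build kalg
  kmulA kmul1 kmulr1 kmulDl kmulDr.

Lemma kscaleAl c (a b : kalg) : c *: (a * b) = (c *: a) * b.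
Proof.
have E : kmul 0 b = 0 := mul0r b.
by have := kmul_linearl b c a 0; rewrite /= E !addr0 => /esym.
Qed.

Lemma kscaleAr c (a b : kalg) : c *: (a * b) = a * (c *: b).
Proof.
have E : kmul a 0 = 0 := mulr0 a.
by have := kmul_linearr a c b 0; rewrite E !addr0 => /esym.
Qed.

Lemma kwordM u v : kword u * kword v = kword (u ++ v).
Proof. exact: kmul_word. Qed.

Definition kdgen (a : kgen) : kalg :=
  match a with
  | gf | gg => 0
  | gr1 => kword [:: gg; gf] - 1
  | gr2 => kword [:: gf; gg] - 1
  | gr12 => kword [:: gf; gr1] - kword [:: gr2; gf]
  end.

Fixpoint kdword (w : seq kgen) : kalg :=
  if w is a :: w' then
    kdgen a * kword w' + (-1) ^+ kgdeg a *: (kword [:: a] * kdword w')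
  else 0.

Definition kdif : kalg -> kalg := kext kdword.
Definition ksign : kalg -> kalg := kext (fun w => (-1) ^+ kdeg w *: kword w).

HB.instance Definition _ :=
  GRing.isLinear.Build k kalg kalg *:%R kdif (kext_linear kdword).
HB.instance Definition _ :=
  GRing.isLinear.Build k kalg kalg *:%R ksign (kext_linear _).

Lemma kdifM a b : kdif (a * b) = kdif a * b + ksign a * kdif b.
Proof.
move: a; apply: kalg_linear_eq => [z a a'|z a a'|u].
- by rewrite mulrDl -kscaleAl linearP.
- by rewrite !linearP !mulrDl -!kscaleAl scalerDr addrACA.
move: b; apply: kalg_linear_eq => [z b b'|z b b'|v].
- by rewrite mulrDr -kscaleAr linearP.
- by rewrite linearP !mulrDr -!kscaleAr scalerDr addrACA.
rewrite kwordM /kdif /ksign !kext_word.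
elim: u => [|a u IH] /=; first by rewrite mul0r add0r scale1r mul1r.
rewrite IH mulrDl -mulrA kwordM -addrA; congr (_ + _).
rewrite mulrDr scalerDr; congr (_ + _); first by rewrite mulrA kscaleAl.
rewrite mulrA -kscaleAr -!kscaleAl scalerA kwordM /kdeg /= exprD.
by [].
Qed.

Lemma kdif_kdif a : kdif (kdif a) = 0.
Proof.
move: a; apply: kalg_linear_eq => [z a a'|z a a'|w].
- by rewrite !linearP.
- by rewrite scaler0 addr0.
rewrite {2}/kdif kext_word; elim: w => [|a w IH] /=; first exact: linear0.
have d1 : kdif 1 = 0 by rewrite [1]/(kword [::]) /kdif kext_word.
have dg b : kdif (kword [:: b]) = kdgen b.
  by rewrite /kdif kext_word /= mulr1 mulr0 scaler0 addr0.
have sg b : ksign (kword [:: b]) = (-1) ^+ kgdeg b *: kword [:: b].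
  by rewrite /ksign kext_word /kdeg /= addn0.
have s1 : ksign 1 = 1 by rewrite [1]/(kword [::]) /ksign kext_word scale1r.
rewrite linearD linearZ /= !kdifM IH mulr0 addr0 dg.
have w2 b c : kword [:: b; c] = kword [:: b] * kword [:: c] by rewrite kwordM.
have ddg : kdif (kdgen a) = 0.
  case: a; rewrite /kdgen.
  - exact: linear0.
  - exact: linear0.
  - by rewrite linearB /= d1 w2 kdifM !dg /= mul0r mulr0 addr0 subr0.
  - by rewrite linearB /= d1 w2 kdifM !dg /= mul0r mulr0 addr0 subr0.
  have E b c : kdif (kword [:: b] * kword [:: c]) =
    kdgen b * kword [:: c] + (-1) ^+ kgdeg b *: kword [:: b] * kdgen c.
    by rewrite kdifM !dg sg.
  rewrite (w2 gf) (w2 gr2).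
  apply: (etrans (linearB kdif _ _)).
  apply: (etrans (congr2 (fun x y => x - y) (E gf gr1) (E gr2 gf))).
  rewrite [kdgen gf]/= [kdgen gr1]/= [kdgen gr2]/= [kgdeg gf]/= !w2.
  rewrite mul0r mulr0 add0r addr0 expr0 scale1r mulrBr mulr1 mulrBl mul1r.
  by rewrite mulrA opprB addrA subrK subrr.
have sdg : ksign (kdgen a) = - ((-1) ^+ kgdeg a *: kdgen a).
  have sw u : ksign (kword u) = (-1) ^+ kdeg u *: kword u by rewrite /ksign kext_word.
  case: a {ddg}; rewrite /kdgen /kgdeg.
  - by rewrite linear0 scaler0 oppr0.
  - by rewrite linear0 scaler0 oppr0.
  - by rewrite linearB /= sw s1 [kdeg _]/= expr0 expr1 scale1r scaleN1r opprK.
  - by rewrite linearB /= sw s1 [kdeg _]/= expr0 expr1 scale1r scaleN1r opprK.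
  rewrite linearB /= !sw [kdeg _]/= [kdeg [:: gr2; gf]]/= sqrrN expr1n expr1.
  by rewrite scale1r !scaleN1r opprK opprB addrC.
rewrite ddg mul0r add0r sdg mulNr -kscaleAl.
rewrite [kdif (kword w)]/kdif kext_word addrC.
by rewrite subrr.
Qed.

Definition khom_pred (x y : bool) (n : int) : {pred kalg} :=
  fun a => all (fun w => kpath x y w && (Posz (kdeg w) == n)) (msupp a).

Lemma khomP x y n (a : kalg) :
  reflect (forall w, w \in msupp a -> kpath x y w /\ Posz (kdeg w) = n)
          (a \in khom_pred x y n).
Proof.
apply: (iffP allP) => h w /h => [/andP[? /eqP]|[-> ->]] //; exact: eqxx.
Qed.

Lemma khom_submod_closed x y n : submod_closed (khom_pred x y n).
Proof.
split; first by apply/khomP => w; rewrite msupp0 in_fset0.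
move=> c a b /khomP ha /khomP hb; apply/khomP => w.
rewrite -mcoeff_neq0 mcoeffD kalg_scaleE.
case: (msuppP a w) => [/ha //|_]; case: (msuppP b w) => [/hb //|_].
by rewrite mulr0 addr0 eqxx.
Qed.
HB.instance Definition _ x y n :=
  GRing.isSubmodClosed.Build k kalg (khom_pred x y n) (khom_submod_closed x y n).

Lemma kword_hom x y n w : kpath x y w -> Posz (kdeg w) = n ->
  kword w \in khom_pred x y n.
Proof.
move=> wp wn; apply/khomP => v vw.
by have /fsubsetP/(_ v vw) := @msuppU_le _ _ w (1 : k); rewrite inE => /eqP->.
Qed.

Lemma kext_hom x y n x' y' n' (h : seq kgen -> kalg) a :
  (forall w, kpath x y w -> Posz (kdeg w) = n -> h w \in khom_pred x' y' n') ->
  a \in khom_pred x y n -> kext h a \in khom_pred x' y' n'.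
Proof.
move=> hh /khomP ha; rewrite /kext big_seq; apply: rpred_sum => w /ha[wp wn].
by apply: rpredZ; exact: hh.
Qed.

Lemma kmul_hom x y z m n p (e : m + n = p) a b :
  a \in khom_pred y z m -> b \in khom_pred x y n -> a * b \in khom_pred x z p.
Proof.
move=> ha hb; apply: (kext_hom _ ha) => u up um.
apply: (kext_hom _ hb) => v vp vn; apply: kword_hom; first exact: kpath_cat up vp.
by rewrite kdeg_cat PoszD um vn.
Qed.

Lemma kdgen_hom a (n : int) : Posz (kgdeg a) = n + 1 ->
  kdgen a \in khom_pred (ksrc a) (ktgt a) n.
Proof.
move=> e; have {e} -> : n = Posz (kgdeg a) - 1 by rewrite e addrK.
by case: a => /=; rewrite ?rpred0 // rpredB //; exact: kword_hom.
Qed.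

Lemma kdword_hom x y n w : kpath x y w -> Posz (kdeg w) = n + 1 ->
  kdword w \in khom_pred x y n.
Proof.
elim: w y n => [|a w IH] y n /=; first by rewrite rpred0.
move=> /andP[/eqP<- wp]; rewrite /kdeg /= -/(kdeg w) => e.
apply: rpredD.
  apply: (@kmul_hom _ (ksrc a) _ (Posz (kgdeg a) - 1) (kdeg w)).
  - by rewrite addrAC -PoszD e addrK.
  - by apply: kdgen_hom; rewrite subrK.
  - exact: kword_hom.
apply: rpredZ; apply: (@kmul_hom _ (ksrc a) _ (kgdeg a) (Posz (kdeg w) - 1)).
- by rewrite addrA -PoszD e addrK.
- by apply: kword_hom; rewrite /= ?eqxx // /kdeg /= addn0.
- by apply: IH => //; rewrite subrK.
Qed.

Lemma kdif_hom x y m n (e : m = n + 1) a :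
  a \in khom_pred x y m -> kdif a \in khom_pred x y n.
Proof. by move=> ha; apply: (kext_hom _ ha) => w wp wm; apply: kdword_hom; rewrite ?wm. Qed.

Lemma ksign_hom x y m a : a \in khom_pred x y m -> ksign a = (-1) ^+ `|m|%N *: a.
Proof.
move=> /khomP ha; rewrite {2}(kalgE a) /ksign /kext scaler_sumr.
rewrite big_seq [RHS]big_seq; apply: eq_bigr => w /ha[_ <-].
by rewrite !scalerA mulrC.
Qed.

Section KHom.
Variables x y : bool.

Definition khom_dif m n (e : m = n + 1) (a : submod (khom_pred x y m)) :
  submod (khom_pred x y n) := Submod (kdif_hom e (submod_mem a)).

Lemma khom_dif_linear m n (e : m = n + 1) : linear (@khom_dif m n e).
Proof. by move=> c a b; apply: val_inj; rewrite /= linearP. Qed.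

Lemma khom_dif_dif m n p (e : m = n + 1) (e' : n = p + 1)
  (a : submod (khom_pred x y m)) : khom_dif e' (khom_dif e a) = 0.
Proof. by apply: val_inj; exact: kdif_kdif. Qed.

Definition khom : complex k :=
  @Complex k (fun n => submod (khom_pred x y n))
    (fun m n e => lin (@khom_dif_linear m n e)) khom_dif_dif.

Lemma nonneg_khom : nonneg_complex khom.
Proof.
move=> n a n0; apply: val_inj; have /khomP ha := valP a.
apply/eqP; rewrite -[_ == _]negbK; apply/negP => /eqP na; apply: na.
apply/malgP => w; rewrite mcoeff0; apply: mcoeff_outdom; apply/negP => /ha[_ wn].
by move: n0; rewrite -wn.
Qed.
End KHom.

Definition khom_comp (x y z : bool) m n p (e : m + n = p) (b : khom y z m)
  (a : khom x y n) : khom x z p := Submod (kmul_hom e (submod_mem b) (submod_mem a)).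

Lemma kone_hom x : (1 : kalg) \in khom_pred x x 0.
Proof. by apply: kword_hom => //=. Qed.

Definition khom_one (x : bool) : khom x x 0 := Submod (kone_hom x).

Lemma khom_comp_linearl (x y z : bool) m n p (e : m + n = p) (a : khom x y n) :
  linear (fun b : khom y z m => khom_comp e b a).
Proof. by move=> c b b'; apply: val_inj; rewrite /= mulrDl kscaleAl. Qed.

Lemma khom_comp_linearr (x y z : bool) m n p (e : m + n = p) (b : khom y z m) :
  linear (fun a : khom x y n => khom_comp e b a).
Proof. by move=> c a a'; apply: val_inj; rewrite /= mulrDr kscaleAr. Qed.

Lemma khom_comp_dif (x y z : bool) (m n p m' n' p' : int)
    (em : m = m' + 1) (en : n = n' + 1) (ep : p = p' + 1)
    (e : m + n = p) (el : m' + n = p') (er : m + n' = p')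
    (b : khom y z m) (a : khom x y n) :
  dif ep (khom_comp e b a) =
    khom_comp el (dif em b) a + (-1) ^+ `|m|%N *: khom_comp er b (dif en a).
Proof.
by apply: val_inj; rewrite /= kdifM (ksign_hom (submod_mem b)) kscaleAl.
Qed.

Lemma khom_one_dif (x : bool) n (e : 0 = n + 1) : dif e (khom_one x) = 0.
Proof. by apply: val_inj; rewrite /= [1]/(kword [::]) /kdif kext_word. Qed.

Lemma khom_compA (x y z t : bool) (m n p mn np q : int)
    (emn : m + n = mn) (enp : n + p = np) (e : m + np = q) (e' : mn + p = q)
    (c : khom z t m) (b : khom y z n) (a : khom x y p) :
  khom_comp e c (khom_comp enp b a) = khom_comp e' (khom_comp emn c b) a.
Proof. by apply: val_inj; exact: mulrA. Qed.

Lemma khom_comp1f (x y : bool) n (e : 0 + n = n) (a : khom x y n) :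
  khom_comp e (khom_one y) a = a.
Proof. by apply: val_inj; exact: mul1r. Qed.

Lemma khom_compf1 (x y : bool) n (e : n + 0 = n) (a : khom x y n) :
  khom_comp e a (khom_one x) = a.
Proof. by apply: val_inj; exact: mulr1. Qed.

Definition Kdgcat : dgcat k :=
  DGCat khom_comp_linearl khom_comp_linearr khom_comp_dif khom_one_dif
    khom_compA khom_comp1f khom_compf1.

Lemma nonneg_Kdgcat : nonneg_dgcat Kdgcat.
Proof. by move=> x y; exact: nonneg_khom. Qed.
End WordAlgebra.

Section Generators.
Variable k : comPzRingType.

(* In [B], [C(n)] and [P(n)] the objects [4], [8], [6] are [false] and the
   objects [5], [9], [7] are [true]. *)
Definition Bdgcat : dgcat k := arrow_dgcat (zero_complex k).
Definition Cdgcat (n : int) : dgcat k := arrow_dgcat (sphere k (n - 1)).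
Definition Pdgcat (n : int) : dgcat k := arrow_dgcat (disk k n).

Definition Ffun : dgfunctor (unit_dgcat k) (Kdgcat k) :=
  unit_dgfunctor (A := Kdgcat k) false.
Definition Qfun : dgfunctor (empty_dgcat k) (unit_dgcat k) :=
  empty_dgfunctor (unit_dgcat k).
Definition Rfun (n : int) : dgfunctor Bdgcat (Pdgcat n) :=
  arrow_dgfunctor (zero_map (disk k n)).
Definition Sfun (n : int) : dgfunctor (Cdgcat n) (Pdgcat n) :=
  arrow_dgfunctor (sphere_disk k n).
Definition Nfun : dgfunctor Bdgcat (Cdgcat 1) :=
  arrow_dgfunctor (zero_map (sphere k (1 - 1))).

Inductive gen_cof : mor_class (DGCAT k) :=
| gen_cof_Q : @gen_cof (empty_dgcat k) (unit_dgcat k) Qfun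
| gen_cof_S (n : int) : @gen_cof (Cdgcat n) (Pdgcat n) (Sfun n).

Inductive gen_tcof : mor_class (DGCAT k) :=
| gen_tcof_F : @gen_tcof (unit_dgcat k) (Kdgcat k) Ffun
| gen_tcof_R (n : int) : @gen_tcof Bdgcat (Pdgcat n) (Rfun n).

Lemma nonneg_Cdgcat n : 1 <= n -> nonneg_dgcat (Cdgcat n).
Proof. by move=> n1; apply: nonneg_arrow_dgcat; apply: nonneg_sphere; rewrite subr_ge0. Qed.

Lemma nonneg_Pdgcat n : 1 <= n -> nonneg_dgcat (Pdgcat n).
Proof.
by move=> n1; apply: nonneg_arrow_dgcat; apply: nonneg_cone; apply: nonneg_sphere;
  rewrite subr_ge0.
Qed.

Definition empty_ge0 : DGCAT_ge0 k := exist _ (empty_dgcat k) (@nonneg_empty_dgcat k).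
Definition unit_ge0 : DGCAT_ge0 k := exist _ (unit_dgcat k) (@nonneg_unit_dgcat k).
Definition K_ge0 : DGCAT_ge0 k := exist _ (Kdgcat k) (@nonneg_Kdgcat k).
Definition B_ge0 : DGCAT_ge0 k :=
  exist _ Bdgcat (nonneg_arrow_dgcat (@nonneg_zero_complex k)).
Definition C_ge0 (n : int) (n1 : 1 <= n) : DGCAT_ge0 k :=
  exist _ (Cdgcat n) (nonneg_Cdgcat n1).
Definition P_ge0 (n : int) (n1 : 1 <= n) : DGCAT_ge0 k :=
  exist _ (Pdgcat n) (nonneg_Pdgcat n1).

Inductive gen_cof_ge0 : mor_class (DGCAT_ge0 k) :=
| gen_cof_ge0_Q : @gen_cof_ge0 empty_ge0 unit_ge0 Qfun
| gen_cof_ge0_N : @gen_cof_ge0 B_ge0 (C_ge0 (lexx 1)) Nfun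
| gen_cof_ge0_S (n : int) (n1 : 1 <= n) :
    @gen_cof_ge0 (C_ge0 n1) (P_ge0 n1) (Sfun n).

Inductive gen_tcof_ge0 : mor_class (DGCAT_ge0 k) :=
| gen_tcof_ge0_F : @gen_tcof_ge0 unit_ge0 K_ge0 Ffun
| gen_tcof_ge0_R (n : int) (n1 : 1 <= n) :
    @gen_tcof_ge0 B_ge0 (P_ge0 n1) (Rfun n).

Definition quasi_equivalences : mor_class (DGCAT k) :=
  fun A B G => quasi_equivalence G.

Definition quasi_equivalences_ge0 : mor_class (DGCAT_ge0 k) :=
  fun A B G => quasi_equivalence (fmor (dgcat_inclusion k) G).

End Generators.

(* Main.v *)
Require Import Defs.
From mathcomp Require Import all_boot all_order all_algebra.

(**
  Lifting problems transpose along the adjunction.  The inclusion sends generating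
  trivial cofibrations to generating trivial cofibrations, hence truncation
  preserves fibrations.  The counit of the truncation is an isomorphism on homology
  in nonnegative degrees, hence truncation also preserves quasi-equivalences.  So
  truncation preserves trivial fibrations, and the inclusion of a cofibration lifts
  against all trivial fibrations; by the retract argument it is a cofibration.  The
  weak equivalences on the nonnegative side are those detected by the inclusion.
*)

Set Implicit Arguments.
Unset Strict Implicit.
Unset Printing Implicit Defensive.

Import Order.TTheory GRing.Theory Num.Theory.
Import Defs.
Local Open Scope ring_scope.

Section AdjointLifting.
Variables (C D : category) (L : functor C D) (R : functor D C).
Variable adj : adjunction L R.

(** A diagonal filling the transposed square is transposed back; naturality and the triangle
    identities show that it fills the original square. *)
Lemma adj_lifts (a b : C) (x y : D) (i : hom a b) (p : hom x y) :
  lifts (fmor L i) p <-> lifts i (fmor R p).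
Proof.
split=> lift u v sq.
- have [|h [hi ph]] := lift (compm (adj_counit adj x) (fmor L u))
    (compm (adj_counit adj y) (fmor L v)).
    by rewrite compmA (adj_counit_nat adj) -!compmA -!fmorM sq.
  exists (compm (fmor R h) (adj_unit adj b)); split.
    rewrite -compmA (adj_unit_nat adj) compmA -fmorM hi fmorM -compmA.
    by rewrite -(adj_unit_nat adj) compmA (adj_triR adj) comp1m.
  rewrite compmA -fmorM ph fmorM -compmA.
  by rewrite -(adj_unit_nat adj) compmA (adj_triR adj) comp1m.
have [|h [hi ph]] := lift (compm (fmor R u) (adj_unit adj a))
    (compm (fmor R v) (adj_unit adj b)).
  by rewrite compmA -fmorM sq fmorM -!compmA (adj_unit_nat adj).
exists (compm (adj_counit adj x) (fmor L h)); split.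
  rewrite -compmA -fmorM hi fmorM compmA.
  by rewrite -(adj_counit_nat adj) -compmA (adj_triL adj) compm1.
rewrite compmA (adj_counit_nat adj) -compmA -fmorM ph fmorM compmA.
by rewrite -(adj_counit_nat adj) -compmA (adj_triL adj) compm1.
Qed.
End AdjointLifting.

(** The retract argument: factor [i] as a cofibration [j] followed by a trivial fibration [p]; a
    lift of [i] against [p] makes [i] a retract of [j]. *)
Lemma cof_llp (C : category) (M : model_structure C) (a b : C) (i : hom a b) :
  (forall (x y : C) (p : hom x y), meet_class (@fib C M) (@weq C M) p ->
    lifts i p) -> cof M i.
Proof.
move=> hi; have [z [j [p [cj tp pj]]]] := cof_tfib_factor M i.
have [|h [hj ph]] := hi _ _ p tp j (idm b); first by rewrite pj comp1m.
apply: (cof_retract _ cj).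
by exists (idm a), (idm a), h, p; split; rewrite ?compm1 ?comp1m.
Qed.

Lemma left_quillen_cof (C D : category) (MC : model_structure C)
    (MD : model_structure D) (L : functor C D) (R : functor D C)
    (adj : adjunction L R) (a b : C) (i : hom a b) :
  right_quillen MC MD R -> cof MC i -> cof MD (fmor L i).
Proof.
move=> hR ci; apply: cof_llp => x y p [fp wp]; apply/(adj_lifts adj).
by apply: cof_lift ci _; exact: (hR _ _ p).2.
Qed.

Definition fully_faithful (C D : category) (F : functor C D) : Prop :=
  forall x y : C, bijective (@fmor C D F x y).

Lemma fully_faithful_isomorphic (C D : category) (F : functor C D) (x y : C) :
  fully_faithful F -> isomorphic (F x) (F y) -> isomorphic x y.
Proof.
move=> ff [f [g [gf fg]]].
have [f' _ Ff] := ff x y; have [g' _ Fg] := ff y x.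
exists (f' f), (g' g); split.
- by apply: (bij_inj (ff x x)); rewrite fmorM fmor1 Ff Fg.
- by apply: (bij_inj (ff y y)); rewrite fmorM fmor1 Ff Fg.
Qed.

Section Truncation.
Variable k : comPzRingType.
Implicit Types M N : complex k.

Lemma homology_map_comp M N P (g : chain_map N P) (f : chain_map M N) n c :
  homology_map (chain_comp g f) (n := n) c = homology_map g (homology_map f c).
Proof.
by rewrite -(hclassK c) !homology_mapE; congr hclass; exact: val_inj.
Qed.

Lemma homology_nonneg M n (c c' : homology M n) :
  nonneg_complex M -> n < 0 -> c = c'.
Proof.
move=> hM n0; rewrite -(hclassK c) -(hclassK c'); congr hclass.
by apply: val_inj; rewrite (hM _ (val (repr c)) n0) (hM _ (val (repr c')) n0).
Qed.

Lemma cycle_trunc M n (z : cycles M n) : 0 <= n -> val z \in @trunc_pred k M n.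
Proof.
move=> n0; apply/trunc_predP; split; first by rewrite ltNge n0.
by move=> _ m e; exact: cycleP.
Qed.

Lemma trunc_cycle_subproof M n (n0 : 0 <= n) (z : cycles M n) :
  (Submod (cycle_trunc z n0) : trunc M n) \in @cycle_pred k (trunc M) n.
Proof. by apply: (mem_cycle (e := int_pred1K n)); apply: val_inj; exact: cycleP. Qed.

Definition trunc_cycle M n (n0 : 0 <= n) (z : cycles M n) : cycles (trunc M) n :=
  Submod (trunc_cycle_subproof n0 z).

(** In degree [n >= 0] truncation keeps every cycle, and it keeps all of degree [n + 1], hence every
    boundary. *)
Lemma homology_trunc_val M n :
  0 <= n -> bijective (@homology_map k _ _ (trunc_val M) n).
Proof.
move=> n0; exists (fun c => hclass (trunc_cycle n0 (repr c))) => c; last first.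
  rewrite homology_mapE -[RHS]hclassK; congr hclass; exact: val_inj.
rewrite -(hclassK c) homology_mapE.
have /hclassP[y hy] := hclassK (hclass (cycle_map (trunc_val M) (repr c))).
(* The bounding chain has degree at least 1, where truncation imposes no condition. *)
have ty : y \in @trunc_pred k M (n + 1).
  have n1 : 0 < n + 1 by rewrite ltzD1.
  by apply/trunc_predP; split=> n1'; [rewrite ltNge ltW in n1'|rewrite n1' in n1].
by apply/hclassP; exists (Submod ty); exact: val_inj.
Qed.

Lemma trunc_quasi_isomorphism M N (f : chain_map M N) :
  quasi_isomorphism f -> quasi_isomorphism (trunc_map f).
Proof.
move=> hf n; have [n0|n0] := ltP n 0.
  (* In negative degrees both homology groups are trivial, so a constant map is inverse. *)
  by exists (fun=> hclass 0) => c; apply: homology_nonneg n0; exact: nonneg_trunc.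
have hM := homology_trunc_val M n0; have [v vK Kv] := homology_trunc_val N n0.
have sq c : homology_map f (homology_map (trunc_val M) c) =
    homology_map (trunc_val N) (homology_map (trunc_map f) (n := n) c).
  rewrite -!homology_map_comp; apply: (congr1 (fun g => homology_map g c)).
  exact: chain_map_eq.
(* By the naturality square, the truncated map on homology is a composite of three bijections, the
   last being the inverse [v] of the counit of [N]. *)
apply: (eq_bij (f := v \o (homology_map f (n := n) \o
    homology_map (trunc_val M) (n := n)))).
  by apply: bij_comp; [exact: Bijective Kv vK|exact: bij_comp].
by move=> c; rewrite /= sq vK.
Qed.

Lemma H0_trunc_counit (A : dgcat k) : fully_faithful (H0_functor (trunc_counit A)).
Proof. by move=> x y; exact: homology_trunc_val. Qed.

Lemma trunc_quasi_equivalence (A B : dgcat k) (G : dgfunctor A B) :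
  quasi_equivalence G -> quasi_equivalence (trunc_dgfunctor G).
Proof.
move=> [qG eG]; split=> [x y|y]; first exact: trunc_quasi_isomorphism.
(* The counit is the identity on objects and fully faithful on [H0], so the isomorphism in [H0 B]
   comes from one in [H0] of the truncation. *)
have [x Gxy] := eG y; exists x.
exact: (fully_faithful_isomorphic (@H0_trunc_counit B)).
Qed.
End Truncation.

Theorem proposition4p18 (k : comPzRingType)
    (M0 : model_structure (DGCAT_ge0 k)) (M : model_structure (DGCAT k))
    (hM0 : cofibrantly_generated_by M0 (@quasi_equivalences_ge0 k)
             (@gen_cof_ge0 k) (@gen_tcof_ge0 k))
    (hM : cofibrantly_generated_by M (@quasi_equivalences k)
            (@gen_cof k) (@gen_tcof k)) :
  quillen_adjunction M0 M (inclusion_truncation_adjunction k).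
Proof.
have [w0 f0 _] := hM0; have [w f _] := hM.
have fibR (A B : DGCAT k) (G : hom A B) : fib M G -> fib M0 (fmor (truncation k) G).
  move=> /f fG; apply/f0 => a b j hj.
  apply: (adj_lifts (inclusion_truncation_adjunction k) j G).1; apply: fG.
  (* The inclusion sends [F] to [F] and [R(n)], [n >= 1], to [R(n)]. *)
  by case: hj => [|n n1]; [exact: gen_tcof_F|exact: gen_tcof_R].
have hR : right_quillen M0 M (truncation k).
  move=> A B G; split=> [|[fG /w wG]]; first exact: fibR.
  by split; [exact: fibR|apply/w0; exact: trunc_quasi_equivalence].
split=> // A B G; have cofL := left_quillen_cof (inclusion_truncation_adjunction k) hR.
split=> [|[cG /w0 wG]]; first exact: cofL.
by split; [exact: cofL|exact/w].
Qed.
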